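(* Let $c_0,\delta_0>0$ and let $a\in[0,1]^{\mathbb{Z}}$ be an irreducible, aperiodic sequence. Let $\epsilon>0$. There are $c_-,c_+,C\in(0,+\infty)$, $\lambda_0\geq 0$, $n_0\geq 1$ such that for any $n\geq n_0$ and any independent sequence $X_1,\dots,X_n$ of random variables with laws in $\mathcal{M}_{\delta_0,c_0}^a$ the following holds, with $m_n=\sum_{i=1}^nE(X_i)$. (1) For any $\sqrt n\geq\lambda\geq\lambda_0$ and any $x\in\mathbb{Z}-m_n$ with $|x|\leq(1-\epsilon)\lambda$, $$P_0\bigl(\max_{i=1,\dots,n}|\bar S_i|\leq\lambda,\ \bar S_n=x\bigr)\geq\frac{1}{C\lambda}\exp\Bigl(-\frac{c_-n}{\lambda^2}\Bigr).$$ (2) For any $\sqrt n\geq\lambda\geq\lambda_0$ and any $x\in\mathbb{Z}-m_n$ with $|x|\leq\lambda$, $$P_0\bigl(\max_{i=1,\dots,n}|\bar S_i|\leq\lambda,\ \bar S_n=x\bigr)\leq\frac{C}{\lambda}\exp\Bigl(-\frac{c_+n}{\lambda^2}\Bigr).$$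
   Context: Write $\bar X_i=X_i-E(X_i)$. Under $P_0$, $\bar S_0=0$ and $\bar S_k=\bar X_1+\dots+\bar X_k$. $\mathbb{Z}-m_n=\{k-m_n:k\in\mathbb{Z}\}$. $\mathcal{M}_{\mathbb{Z}}$ is the set of probability measures on $\mathbb{Z}$; $p(i)$ is the mass of $p$ at $i$. A measure $p\in\mathcal{M}_{\mathbb{Z}}$ is called irreducible (resp. aperiodic) if the random walk on $\mathbb{Z}$ with i.i.d. steps of law $p$ is an irreducible (resp. aperiodic) Markov chain. A sequence $a=(a_i)_{i\in\mathbb{Z}}\in[0,1]^{\mathbb{Z}}$ is irreducible and aperiodic if there are an irreducible and aperiodic $p\in\mathcal{M}_{\mathbb{Z}}$ and numbers $b_i>0$, $i\in\mathbb{Z}$, with $a_i=b_ip(i)$ for all $i$. For $\delta,c>0$, $$\mathcal{M}_{\delta,c}^a=\Bigl\{p\in\mathcal{M}_{\mathbb{Z}}:\ \sup_{|t|\leq\delta}\sum_{k\in\mathbb{Z}}p(k)e^{tk}\leq c,\ p(i)\geq a_i\ \forall i\in\mathbb{Z}\Bigr\}.$$ *)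

(* Defs.v *)
From HB Require Import structures.
From mathcomp Require Import all_boot all_order all_algebra.
From mathcomp Require Import all_classical all_reals all_analysis.

Set Implicit Arguments.
Unset Strict Implicit.
Unset Printing Implicit Defensive.

Import Order.TTheory GRing.Theory Num.Theory.
Import numFieldNormedType.Exports.

Local Open Scope classical_set_scope.
Local Open Scope ring_scope.

(* With the discrete sigma-algebra on [int], [probability int R] is the type
   of all probability measures on Z, and [{RV P >-> int}] the type of
   integer-valued random variables. *)
HB.instance Definition _ := isPointed.Build int 0.

HB.instance Definition _ := @isMeasurable.Build default_measure_display
  int discrete_measurable discrete_measurable0
  discrete_measurableC discrete_measurableU.

Section MarkovChain.
Context {R : realType} {S : choiceType}.
Variable Q : S -> S -> \bar R.
Local Open Scope ereal_scope.

Fixpoint nstep (n : nat) (x y : S) : \bar R :=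
  if n is m.+1 then \esum_(z in [set: S]) (Q x z * nstep m z y)
  else (x == y)%:R%:E.

Definition irreducible_chain : Prop :=
  forall x y : S, exists n : nat, 0 < nstep n x y.

(* [d] is the gcd of the set of positive return times to [x]; the gcd of the
   empty set is 0. *)
Definition is_period (x : S) (d : nat) : Prop :=
  forall e : nat,
    (forall n : nat, (0 < n)%N -> 0 < nstep n x x -> (e %| n)%N) <->
    (e %| d)%N.

Definition aperiodic_chain : Prop := forall x : S, is_period x 1.

End MarkovChain.

Section MeasuresOnZ.
Context {R : realType}.
Implicit Type p : probability int R.

Definition walk_transition p (x y : int) : \bar R := p [set y - x].

Definition irreducible_measure p : Prop :=
  irreducible_chain (walk_transition p).

Definition aperiodic_measure p : Prop := aperiodic_chain (walk_transition p).

Definition irreducible_aperiodic_seq (a : int -> R) : Prop :=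
  exists p : probability int R,
    [/\ irreducible_measure p, aperiodic_measure p &
        exists b : int -> R, (forall i, 0 < b i) /\
          (forall i, (a i)%:E = ((b i)%:E * p [set i])%E)].

Definition Mclass (delta c : R) (a : int -> R) : set (probability int R) :=
  [set p | (ereal_sup
              [set \esum_(k in [set: int]) (p [set k] * (expR (t * k%:~R))%:E)
              | t in [set t : R | (`|t| <= delta)%R]] <= c%:E)%E /\
           (forall i, ((a i)%:E <= p [set i])%E)].

End MeasuresOnZ.

Definition independent_RVs {R : realType} {d d' : measure_display}
    {T : measurableType d} {T' : measurableType d'} {P : probability T R}
    {I : finType} (X : I -> {RV P >-> T'}) : Prop :=
  forall (J : {set I}) (A : I -> set T'),
    (forall i, i \in J -> measurable (A i)) ->
    P [set w | forall i, i \in J -> A i (X i w)] =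
    (\prod_(i in J) P (X i @^-1` A i))%E.

Section Walk.
Context {R : realType} {d : measure_display} {T : measurableType d}.
Context {P : probability T R} {n : nat}.
Variable X : 'I_n -> {RV P >-> int}.

(* [fine] only serves to read the expectation as a real number: it is finite
   as soon as the law of [X i] has an exponential moment as in [Mclass]. *)
Definition mean (i : 'I_n) : R := fine 'E_P[fun w => (X i w)%:~R].

Definition total_mean : R := \sum_(i < n) mean i.

(* [centered_sum k] is the sum of the first [k] centered variables: [X i] is
   the [i.+1]-st variable of the sequence. *)
Definition centered_sum (k : nat) (w : T) : R :=
  \sum_(i < n | (i < k)%N) ((X i w)%:~R - mean i).

(* The iterated maximum starts from 0, which is harmless for absolute
   values. *)
Definition stay_and_hit (lambda x : R) : set T :=
  [set w | \big[Num.max/0]_(1 <= k < n.+1) `|centered_sum k w| <= lambda /\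
           centered_sum n w = x].

End Walk.

Definition shifted_Z {R : realType} (m : R) : set R :=
  [set k%:~R - m | k in [set: int]].

(* Main.v *)
Require Import Defs.
From mathcomp Require Import all_boot all_order all_algebra.
From mathcomp Require Import all_classical all_reals all_analysis.
From mathcomp Require Import measurable_realfun ring lra zify.

Set Implicit Arguments.
Unset Strict Implicit.
Unset Printing Implicit Defensive.

Import Order.TTheory GRing.Theory Num.Theory.
Import numFieldNormedType.Exports.

Local Open Scope classical_set_scope.
Local Open Scope ring_scope.

(** Let k be a positive mass that a block of L consecutive steps gives to both
    0 and 1, whatever the laws of the steps above the sequence a: such a k
    exists because a is irreducible and aperiodic
    ([irreducible_aperiodic_spreads]). The law of a block is then 2k times the
    law of a fair coin with values in {0, 1}, plus a positive remainder. Given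
    which blocks use the coin, and given the values of the other ones, the walk
    has a shifted binomial law. Elementary bounds on binomial coefficients
    therefore give the local estimates, with no Fourier analysis: the sum S of
    n steps satisfies P(S = x) <= C / sqrt n ([local_upper]) and
    P(S = x) >= c / sqrt n when x is within a multiple of sqrt n of the mean of
    S ([local_lower]); for the second one it is enough that the conditional
    mean of S has a variance at most that of S. Cutting the time interval in
    two halves, and using Chebyshev on one half and the first estimate on the
    other, one gets P(S = x) <= C sqrt n / d^2 when x is at distance d from the
    mean ([local_tail]).

    Upper bound ([kill_delta_upper]). Wherever a block of A lam^2 steps starts,
    it ends in a given window of length 2 lam with probability at most
    C (2 lam + 2) / (sqrt A lam), which is at most 1/2 for A large. Every such
    block costs a factor 2, and the lam^2 steps that remain cost C / lam.

    Lower bound ([kill_delta_lower]). Cut the time into blocks of r^2 steps, r a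
    small multiple of lam, and move a target at constant speed from 0 to x. The
    walk is asked to be close to the target at the end of each block, which has
    a probability bounded from below by [local_lower]. Staying in the strip
    during the block costs little ([kill_block]): a path that leaves the strip
    must come back over a distance A r, an event of probability at most
    C / (A^2 r) by [local_tail], against c / r for the unconstrained walk. The
    number of blocks is of order n / lam^2, and the last one has to hit x
    exactly, whence the factor 1 / lam.

    A law on the integers is handled as the positive linear functional
    h |-> E h(X), and a walk as the list of the functionals of its steps; the
    conditioning above then becomes an induction on this list, with explicit
    super- and subsolutions ([smooth_walk_upper], [smooth_walk_lower]). The
    event of the theorem depends on finitely many integer paths once the strip
    is fixed, and [measure_stay_and_hit] identifies its probability with the
    value of the killed walk. *)

(** * Expectations as positive linear functionals *)

Section Laws.
Context {R : realType}.
Implicit Types (h g : int -> R) (E : (int -> R) -> R).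

(** The estimates on walks involve at most second moments, and quadratic growth
    is stable under translations and under averaging. *)
Definition quad h := exists C, forall z, `|h z| <= C * (1 + z%:~R ^+ 2).

Definition delta (x : int) : int -> R := fun y => (y == x)%:R.

Lemma quad_le h g : quad g -> (forall z, `|h z| <= `|g z|) -> quad h.
Proof. by move=> [C gC] hg; exists C => z; exact: le_trans (hg z) (gC z). Qed.

Lemma quad_cst (r : R) : quad (fun=> r).
Proof.
exists `|r| => z; rewrite ler_peMr// lerDl; exact: sqr_ge0.
Qed.

Lemma quad_bounded h (C : R) : (forall z, `|h z| <= C) -> quad h.
Proof.
move=> hC; apply: quad_le (quad_cst C) _ => z.
by rewrite (le_trans (hC z)) ?ler_norm.
Qed.

Lemma quadD h g : quad h -> quad g -> quad (fun z => h z + g z).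
Proof.
move=> [C hC] [C' gC]; exists (C + C') => z.
by rewrite mulrDl (le_trans (ler_normD _ _))// lerD.
Qed.

Lemma quadZ (a : R) h : quad h -> quad (fun z => a * h z).
Proof.
move=> [C hC]; exists (`|a| * C) => z.
by rewrite normrM -mulrA ler_wpM2l.
Qed.

Lemma quadN h : quad h -> quad (fun z => - h z).
Proof. by move=> qh; apply: (quad_le qh) => z; rewrite normrN. Qed.

Lemma quadB h g : quad h -> quad g -> quad (fun z => h z - g z).
Proof. by move=> qh qg; apply: quadD => //; exact: quadN. Qed.

Lemma quad_delta x : quad (delta x).
Proof.
apply: (@quad_bounded _ 1) => z; rewrite /delta.
by case: eqP; rewrite ?normr1 ?normr0.
Qed.

Lemma quad_sq (c : R) : quad (fun z => (z%:~R + c) ^+ 2).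
Proof.
exists (2 + 2 * c ^+ 2) => z.
rewrite ger0_norm ?sqr_ge0//.
have := sqr_ge0 (z%:~R - c); have := sqr_ge0 (z%:~R * c).
rewrite !expr2; nra.
Qed.

Lemma quad_lin (c : R) : quad (fun z => z%:~R + c).
Proof.
exists (1 + `|c|) => z.
rewrite (le_trans (ler_normD _ _))//.
have := normr_ge0 c; have := sqr_ge0 (`|z%:~R : R| - 1).
rewrite !expr2 => h c0.
have : `|z%:~R| * `|z%:~R| = z%:~R * z%:~R :> R by rewrite -normrM ger0_norm// -expr2 sqr_ge0.
have := sqr_ge0 (z%:~R : R); rewrite expr2; nra.
Qed.

Lemma quad_id : quad (fun z => z%:~R).
Proof. by apply: (quad_le (quad_lin 0)) => z; rewrite addr0. Qed.

Lemma quad_shift_bound h : quad h ->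
  exists C, forall z y, `|h (z + y)| <= C * (1 + z%:~R ^+ 2) * (1 + y%:~R ^+ 2).
Proof.
move=> [C hC]; exists (2 * C) => z y.
apply: (le_trans (hC _)).
have C0 : 0 <= C by have := le_trans (normr_ge0 _) (hC 0); rewrite expr0n addr0 mulr1.
rewrite (mulrC 2) -!mulrA ler_wpM2l// intrD.
have := sqr_ge0 (z%:~R - y%:~R : R); have := sqr_ge0 (z%:~R * y%:~R : R).
have := sqr_ge0 (z%:~R : R).
rewrite !expr2; nra.
Qed.

Lemma quad_shift h z : quad h -> quad (fun y => h (z + y)).
Proof.
by move=> /quad_shift_bound[C hC]; exists (C * (1 + z%:~R ^+ 2)).
Qed.

Lemma quad_shiftr h z : quad h -> quad (fun y => h (y + z)).
Proof.
by move=> qh; under eq_fun do rewrite addrC; exact: quad_shift.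
Qed.

Lemma quad_sum (I : Type) (s : seq I) (F : I -> int -> R) :
  (forall i, quad (F i)) -> quad (fun y => \sum_(i <- s) F i y).
Proof.
move=> qF; elim: s => [|i s IH].
  by under eq_fun do rewrite big_nil; exact: quad_cst.
by under eq_fun do rewrite big_cons; exact: quadD.
Qed.

Lemma quad_if (p : pred int) h g : quad h -> quad g ->
  quad (fun y => if p y then h y else g y).
Proof.
move=> [C hC] [C' gC]; exists (C + C') => z; rewrite mulrDl.
have := le_trans (normr_ge0 _) (hC z); have := le_trans (normr_ge0 _) (gC z).
by move: (hC z) (gC z); case: (p z); lra.
Qed.

(** The functional is only meaningful on functions of quadratic growth; its
    values elsewhere are arbitrary. The axioms ask for finite additivity only:
    in the local estimates, all sums over the integers are over finite windows. *)
Record mean_op := MeanOp {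
  ev :> (int -> R) -> R;
  ev1 : ev (fun=> 1) = 1;
  ev_linear : forall (r : R) h g, quad h -> quad g ->
    ev (fun y => r * h y + g y) = r * ev h + ev g;
  ev_ge0 : forall h, quad h -> (forall z, 0 <= h z) -> 0 <= ev h }.

Section MeanOpTheory.
Variable E : mean_op.

Lemma ev0 : E (fun=> 0) = 0.
Proof.
have := ev_linear E (-1) (quad_cst 1) (quad_cst 1).
under eq_fun do rewrite mulr1 addNr.
by rewrite ev1 => ->; lra.
Qed.

Lemma evD h g : quad h -> quad g -> E (fun y => h y + g y) = E h + E g.
Proof.
move=> qh qg; rewrite -[E h]mul1r -ev_linear//.
by congr (E _); apply/funext => y; rewrite mul1r.
Qed.

Lemma evZ r h : quad h -> E (fun y => r * h y) = r * E h.
Proof.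
move=> qh; rewrite -[RHS]addr0 -ev0 -ev_linear//; last exact: quad_cst.
by congr (E _); apply/funext => y; rewrite addr0.
Qed.

Lemma ev_cst r : E (fun=> r) = r.
Proof.
rewrite -[RHS]mulr1 -(ev1 E) -evZ; last exact: quad_cst.
by congr (E _); apply/funext => y; rewrite mulr1.
Qed.

Lemma evN h : quad h -> E (fun y => - h y) = - E h.
Proof.
move=> qh; rewrite -mulN1r -evZ//.
by congr (E _); apply/funext => y; rewrite mulN1r.
Qed.

Lemma evB h g : quad h -> quad g -> E (fun y => h y - g y) = E h - E g.
Proof. by move=> qh qg; rewrite evD ?evN//; exact: quadN. Qed.

Lemma ev_le h g : quad h -> quad g -> (forall z, h z <= g z) -> E h <= E g.
Proof.
move=> qh qg hg; rewrite -subr_ge0 -evB//; apply: ev_ge0; first exact: quadB.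
by move=> z; rewrite subr_ge0.
Qed.

Lemma ev_sum (I : Type) (s : seq I) (F : I -> int -> R) :
  (forall i, quad (F i)) ->
  E (fun y => \sum_(i <- s) F i y) = \sum_(i <- s) E (F i).
Proof.
move=> qF; elim: s => [|i s IH].
  by under eq_fun do rewrite big_nil; rewrite big_nil ev0.
under eq_fun do rewrite big_cons.
by rewrite big_cons evD ?IH//; exact: quad_sum.
Qed.

Lemma quad_ev h : quad h -> quad (fun z => E (fun y => h (z + y))).
Proof.
move=> qh; have [C hC] := quad_shift_bound qh.
pose g y : R := 1 + y%:~R ^+ 2.
have qg : quad g by exists 1 => z; rewrite mul1r ger0_norm// addr_ge0 ?sqr_ge0.
exists (C * E g) => z.
have qhz := quad_shift z qh.
have -> : C * E g * (1 + z%:~R ^+ 2) = E (fun y => C * (1 + z%:~R ^+ 2) * g y).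
  by rewrite evZ//; ring.
rewrite ler_norml; apply/andP; split.
- rewrite -evN; last exact: quadZ.
  apply: ev_le => //; first by apply/quadN/quadZ.
  by move=> y; have := hC z y; rewrite ler_norml => /andP[].
- apply: ev_le => //; first exact: quadZ.
  by move=> y; have := hC z y; rewrite ler_norml => /andP[].
Qed.

Definition ev_mean := E (fun y => y%:~R).
Definition ev_variance := E (fun y => y%:~R ^+ 2) - ev_mean ^+ 2.

Lemma quad_id2 : quad (fun y => y%:~R ^+ 2).
Proof. by have := quad_sq 0; under eq_fun do rewrite addr0. Qed.

Lemma ev_sq (c : R) : E (fun y => (y%:~R + c) ^+ 2) = (ev_mean + c) ^+ 2 + ev_variance.
Proof.
have -> : (fun y : int => (y%:~R + c) ^+ 2) =
   (fun y => (2 * c) * y%:~R + (y%:~R ^+ 2 + c ^+ 2)).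
  by apply/funext => y; rewrite sqrrD -mulr_natl; ring.
rewrite ev_linear; [|exact: quad_id|apply: quadD (quad_id2) (quad_cst _)].
rewrite evD; [|exact: quad_id2|exact: quad_cst].
by rewrite ev_cst /ev_variance -/ev_mean; ring.
Qed.

End MeanOpTheory.

(** The bounds are part of the type, so that all the sublists of a list of steps
    inherit them. *)
Record law (V : R) (a : int -> R) := Law {
  law_ev :> mean_op;
  law_variance : ev_variance law_ev <= V;
  law_atom : forall x, a x <= law_ev (delta x) }.

(** * Sums of independent steps *)

Section Walk.
Variables (V : R) (a : int -> R).
Implicit Types es : seq (law V a).

(** The mean of [h] at the end of a walk that starts from [z] and has
    independent steps of laws [es]. *)
Fixpoint walk es h (z : int) : R :=
  if es is E :: es' then E (fun y => walk es' h (z + y)) else h z.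

Definition means es := \sum_(E <- es) ev_mean E.
Definition variances es := \sum_(E <- es) ev_variance E.

Lemma means_cat es1 es2 : means (es1 ++ es2) = means es1 + means es2.
Proof. exact: big_cat. Qed.

Lemma variances_le es : variances es <= V * (size es)%:R.
Proof.
rewrite /variances; elim: es => [|E es IH]; first by rewrite big_nil mulr0.
rewrite big_cons /=.
by rewrite -nat1r mulrDr mulr1 lerD//; exact: law_variance.
Qed.

Lemma quad_walk es h : quad h -> quad (walk es h).
Proof. by move=> qh; elim: es => //= E es IH; exact: quad_ev. Qed.

Lemma walk_cat es1 es2 h z :
  walk (es1 ++ es2) h z = walk es1 (walk es2 h) z.
Proof.
elim: es1 z => //= E es IH z.
by congr (ev E _); apply/funext => y.
Qed.

Lemma walk_shift es h u z :
  walk es h (u + z) = walk es (fun y => h (u + y)) z.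
Proof.
elim: es z => //= E es IH z.
by congr (ev E _); apply/funext => y; rewrite -IH addrA.
Qed.

Lemma walk_linear es r h g z : quad h -> quad g ->
  walk es (fun y => r * h y + g y) z = r * walk es h z + walk es g z.
Proof.
move=> qh qg; elim: es z => //= E es IH z.
rewrite -ev_linear; [|exact/quad_shift/quad_walk|exact/quad_shift/quad_walk].
by congr (ev E _); apply/funext => y.
Qed.

Lemma walk_cst es r z : walk es (fun=> r) z = r.
Proof.
elim: es z => //= E es IH z.
by under eq_fun do rewrite IH; exact: ev_cst.
Qed.

Lemma walk_ge0 es h z : quad h -> (forall y, 0 <= h y) -> 0 <= walk es h z.
Proof.
move=> qh h0; elim: es z => //= E es IH z.
by apply: ev_ge0 => //; exact/quad_shift/quad_walk.
Qed.

Lemma walkD es h g z : quad h -> quad g ->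
  walk es (fun y => h y + g y) z = walk es h z + walk es g z.
Proof.
move=> qh qg; rewrite -[walk es h z]mul1r -walk_linear//.
by congr (walk es _ z); apply/funext => y; rewrite mul1r.
Qed.

Lemma walkZ es r h z : quad h -> walk es (fun y => r * h y) z = r * walk es h z.
Proof.
move=> qh; rewrite -[RHS]addr0 -[X in _ + X](walk_cst es 0 z) -walk_linear//.
  by congr (walk es _ z); apply/funext => y; rewrite addr0.
exact: quad_cst.
Qed.

Lemma walk_le es h g z : quad h -> quad g -> (forall y, h y <= g y) ->
  walk es h z <= walk es g z.
Proof.
move=> qh qg hg; elim: es z => //= E es IH z.
by apply: ev_le => [||y]; [exact/quad_shift/quad_walk..|exact: IH].
Qed.

Lemma walk_sum es (I : Type) (s : seq I) (F : I -> int -> R) z :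
  (forall i, quad (F i)) ->
  walk es (fun y => \sum_(i <- s) F i y) z = \sum_(i <- s) walk es (F i) z.
Proof.
move=> qF; elim: s => [|i s IH].
  by under eq_fun do rewrite big_nil; rewrite big_nil walk_cst.
under eq_fun do rewrite big_cons.
by rewrite big_cons walkD ?IH//; exact: quad_sum.
Qed.

(** Independence enters here: the variances of the steps add up because the
    first step is averaged after all the other ones. *)
Lemma walk_sq es c z : walk es (fun y => (y%:~R - c) ^+ 2) z =
  (z%:~R + means es - c) ^+ 2 + variances es.
Proof.
rewrite /means /variances.
elim: es z c => [|E es IH] z c; first by rewrite !big_nil /= !addr0.
rewrite !big_cons /=.
under eq_fun do rewrite IH intrD.
set m := \sum_(E <- es) ev_mean E; set v := \sum_(E <- es) _.
under eq_fun => y do rewrite -addrA -addrA (addrC z%:~R) -addrA.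
rewrite evD; [|exact: quad_sq|exact: quad_cst].
by rewrite ev_sq ev_cst; ring.
Qed.

Lemma walk_id es z : walk es (fun y => y%:~R) z = z%:~R + means es.
Proof.
rewrite /means; elim: es z => [|E es IH] z; first by rewrite big_nil addr0.
rewrite big_cons /=; under eq_fun do rewrite IH intrD addrAC.
rewrite evD; [|exact: quad_cst|exact: quad_id].
by rewrite ev_cst -/(ev_mean E); ring.
Qed.

Lemma walk_chebyshev es h c r z : 0 < r ->
  (forall y, 0 <= h y <= 1) -> (forall y, h y != 0 -> r <= `|y%:~R - c|) ->
  walk es h z <= ((z%:~R + means es - c) ^+ 2 + variances es) / r ^+ 2.
Proof.
move=> r0 h01 hr; rewrite -walk_sq mulrC -walkZ; last exact: quad_sq.
apply: walk_le; first 1 last.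
- exact/quadZ/quad_sq.
- move=> y; have [->|hy] := eqVneq (h y) 0.
    by rewrite mulr_ge0 ?sqr_ge0// invr_ge0 sqr_ge0.
  case/andP: (h01 y) => _ /le_trans; apply.
  rewrite mulrC ler_pdivlMr ?exprn_gt0// mul1r -[leRHS]ger0_norm ?sqr_ge0//.
  by rewrite normrX lerXn2r ?nnegrE ?hr// ltW.
- apply: (@quad_bounded _ 1) => y; case/andP: (h01 y) => h0 h1.
  by rewrite ger0_norm.
Qed.

Lemma walk_le1 es h z : quad h -> (forall y, h y <= 1) -> walk es h z <= 1.
Proof.
by move=> qh h1; rewrite -(walk_cst es 1 z); apply: walk_le => //; exact: quad_cst.
Qed.

End Walk.

Lemma sum_deltaE (s : seq int) (f : int -> R) y : uniq s ->
  \sum_(x <- s) f x * delta x y = (y \in s)%:R * f y.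
Proof.
elim: s => [|x s IH] /=; first by rewrite big_nil mul0r.
case/andP => xs us; rewrite big_cons IH// /delta inE.
have [->|yx] := eqVneq y x; last by rewrite mulr0 add0r.
by rewrite (negbTE xs) mulr1 mul1r mul0r addr0.
Qed.

Lemma ev_ge_atoms (E : mean_op) (s : seq int) (f h : int -> R) :
  uniq s -> quad h -> (forall y, 0 <= h y) ->
  (forall x, x \in s -> f x <= E (delta x)) ->
  \sum_(x <- s) f x * h x <= E h.
Proof.
move=> us qh h0 fE.
have qd x : quad (fun y => h x * delta x y) by exact/quadZ/quad_delta.
apply: (@le_trans _ _ (E (fun y => \sum_(x <- s) h x * delta x y))).
  rewrite ev_sum// !big_seq; apply: ler_sum => x xs.
  by rewrite evZ ?(mulrC (f x)) ?ler_wpM2l ?fE//; exact: quad_delta.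
apply: ev_le => //; first exact: quad_sum.
by move=> y; rewrite sum_deltaE//; case: (y \in s); rewrite ?mul1r ?mul0r.
Qed.

End Laws.

(** * Binomial coefficients *)

Lemma bin_le_central p k : ('C(p.*2, k) <= 'C(p.*2, p))%N.
Proof.
have mono : forall j, (j < p)%N -> ('C(p.*2, j) <= 'C(p.*2, j.+1))%N.
  move=> j jp; rewrite -(leq_pmul2r (ltn0Sn j)) [leqRHS]mulnC mul_bin_left mulnC.
  by rewrite leq_mul2r; apply/orP; right; lia.
have main j : (j <= p)%N -> ('C(p.*2, j) <= 'C(p.*2, p))%N.
  move=> jp; rewrite -(subKn jp); elim: (p - j)%N => [|i IH]; first by rewrite subn0.
  have [pi|ip] := leqP p i; first by have -> : (p - i.+1 = p - i)%N by lia.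
  apply: leq_trans IH; have -> : (p - i = (p - i.+1).+1)%N by lia.
  by apply: mono; lia.
have [|pk] := leqP k p; first exact: main.
have [kp|/bin_small -> //] := leqP k p.*2.
by rewrite -bin_sub//; apply: main; lia.
Qed.

Lemma central_bin_rec p :
  (p.+1 * 'C(p.+1.*2, p.+1) = 2 * p.*2.+1 * 'C(p.*2, p))%N.
Proof.
have := mul_bin_diag p.*2.+2 p; have := mul_bin_down p.*2.+1 p.
rewrite (_ : p.*2.+1 - p = p.+1)%N; last lia.
by rewrite doubleS /= => h <-; lia.
Qed.

(** The central coefficient is of order 4^p / sqrt p. Squaring avoids the square
    root and makes both bounds inductive, as the square of the ratio of two
    consecutive central coefficients is 4 (2p+1)^2 / (p+1)^2. *)
Lemma central_bin_upper p : (('C(p.*2, p) ^ 2 * p.*2.+1 <= 16 ^ p))%N.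
Proof.
elim: p => [//|p IH].
have h := central_bin_rec p.
rewrite -(leq_pmul2l (_ : 0 < p.+1 ^ 2)%N)// mulnA -expnMn h (expnS 16).
rewrite !expnMn.
apply: (@leq_trans (4 * p.*2.+1 * p.+1.*2.+1 * 16 ^ p))%N.
  rewrite (_ : (_ * _ = 4 * p.*2.+1 * p.+1.*2.+1 * ('C(p.*2, p) ^ 2 * p.*2.+1))%N).
    by rewrite leq_mul2l IH orbT.
  by rewrite -!mulnn; ring.
by rewrite mulnA leq_mul2r; apply/orP; right; rewrite -mulnn; nia.
Qed.

Lemma central_bin_lower p : (0 < p)%N -> (16 ^ p <= 'C(p.*2, p) ^ 2 * (4 * p))%N.
Proof.
elim: p => [//|[|p] IH _]; first by [].
have {IH} := IH isT; move: p.+1 (ltn0Sn p) => {}p p0 IH.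
have h := central_bin_rec p.
rewrite -(leq_pmul2l (_ : 0 < p.+1 ^ 2)%N)// mulnA -expnMn h (expnS 16).
rewrite !expnMn.
apply: (@leq_trans (p.+1 ^ 2 * 16 * ('C(p.*2, p) ^ 2 * (4 * p))))%N.
  by rewrite mulnA leq_mul2l IH orbT.
rewrite (_ : (_ * _ = ('C(p.*2, p) ^ 2 * (p.+1 ^ 2 * 64 * p)))%N); last by ring.
rewrite [leqRHS](_ : _ = ('C(p.*2, p) ^ 2 * (2 ^ 2 * p.*2.+1 ^ 2 * (4 * p.+1)))%N); last by ring.
rewrite leq_mul2l; apply/orP; right; rewrite -!mulnn.
rewrite (_ : 64 = 4 * 16)%N//; nia.
Qed.

Section Smooth.
Context {R : realType}.
Implicit Types h : int -> R.

(** The mean of [h] at [v] plus a binomial variable of parameters [n] and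
    1/2. *)
Fixpoint smooth n h (v : int) : R :=
  if n is m.+1 then (smooth m h v + smooth m h (v + 1)) / 2 else h v.

Lemma smooth_deltaE n (x v : int) : smooth n (delta x) v =
  if x - v is Posz k then 'C(n, k)%:R / 2 ^+ n else 0.
Proof.
elim: n v => [|n IH] v /=.
  rewrite /delta eq_sym -subr_eq0; case: (x - v) => [[|k]|k] //=.
  - by rewrite bin0 expr0 divr1.
  - by rewrite bin0n mul0r.
rewrite !{}IH opprD addrA; case: (x - v) => [[|k]|k].
- rewrite (_ : Posz 0 - 1 = Negz 0)// !bin0 addr0 exprS.
  by field; rewrite expf_neq0 ?pnatr_eq0.
- rewrite (_ : Posz k.+1 - 1 = Posz k); last lia.
  by rewrite binS natrD exprS; field; rewrite expf_neq0 ?pnatr_eq0.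
- rewrite (_ : Negz k - 1 = Negz k.+1); last lia.
  by rewrite addr0 mul0r.
Qed.

Lemma smooth_delta_ge0 n x v : 0 <= smooth n (delta x) v.
Proof.
by rewrite smooth_deltaE; case: (x - v) => // k; rewrite divr_ge0// exprn_ge0.
Qed.

Lemma smooth_delta_upper n x v :
  smooth n (delta x) v <= Num.sqrt (2 / n.+1%:R).
Proof.
have even p u : smooth p.*2 (delta x) u <= Num.sqrt (p.*2.+1%:R^-1).
  rewrite -ler_sqr ?nnegrE ?sqrtr_ge0 ?smooth_delta_ge0// sqr_sqrtr ?invr_ge0//.
  rewrite smooth_deltaE; case: (x - u) => [k|k]; last by rewrite expr0n invr_ge0.
  rewrite expr_div_n -exprM mulnC -mul2n mulnA exprM.
  rewrite ler_pdivrMr ?exprn_gt0// mulrC ler_pdivlMr ?ltr0n//.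
  rewrite (_ : 2 ^+ _ = 16%:R); last by rewrite -natrX.
  rewrite -!natrX -natrM ler_nat mul2n; apply: leq_trans (central_bin_upper p).
  by rewrite leq_mul2r leq_sqr bin_le_central orbT.
rewrite -[n]odd_double_half; set p := n./2; case: (odd n) => /=.
  rewrite add1n [smooth _ _ _]/=; apply: (@le_trans _ _ (Num.sqrt (p.*2.+1%:R^-1))).
    by have := even p v; have := even p (v + 1); lra.
  apply: ler_wsqrtr; rewrite ler_pdivlMr ?ltr0n// ler_pdivrMl ?ltr0n//.
  by rewrite -natrM ler_nat; lia.
rewrite add0n; apply: le_trans (even p v) _; apply: ler_wsqrtr.
by rewrite ler_peMl ?invr_ge0// ler1n.
Qed.

(** The odd case is the even case of the next integer, since the coefficient
    C(2p+2, p+1) is twice C(2p+1, p). *)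
Lemma central_mass_lower n :
  Num.sqrt ((2 * n.+1%:R)^-1) <= 'C(n, n./2)%:R / 2 ^+ n :> R.
Proof.
have even p : Num.sqrt ((4 * p%:R)^-1) <= 'C(p.*2, p)%:R / 2 ^+ p.*2 :> R.
  case: p => [|p]; first by rewrite mulr0 invr0 sqrtr0 bin0 expr0 divr1.
  rewrite -ler_sqr ?nnegrE ?sqrtr_ge0 ?divr_ge0 ?exprn_ge0//.
  rewrite sqr_sqrtr ?invr_ge0 ?mulr_ge0//.
  rewrite expr_div_n -exprM mulnC -mul2n mulnA exprM.
  rewrite ler_pdivlMr ?exprn_gt0// ler_pdivrMl ?mulr_gt0 ?ltr0n//.
  rewrite (_ : 2 ^+ _ = 16%:R); last by rewrite -natrX.
  rewrite -!natrX -!natrM ler_nat mul2n mulnC; exact: central_bin_lower.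
have [p np ->] : exists2 p, n = (odd n + p.*2)%N & n./2 = p.
  by exists n./2; rewrite ?odd_double_half.
rewrite {}np; case: (odd n) => /=; last first.
  rewrite add0n; case: p => [|p].
    by rewrite bin0 expr0 divr1 -[leRHS]sqrtr1 ler_wsqrtr// mulr1 invf_le1 ?ler1n ?ltr0n.
  apply: le_trans (even p.+1).
  apply: ler_wsqrtr; rewrite lef_pV2 ?posrE ?mulr_gt0 ?ltr0n//.
  by rewrite -!natrM ler_nat; lia.
have := even p.+1.
rewrite (_ : 4 * p.+1%:R = 2 * (1 + p.*2).+1%:R :> R); last first.
  by rewrite -!natrM; congr (_ %:R); lia.
move/le_trans; apply.
have := mul_bin_diag p.*2.+2 p; rewrite /= => h.
have {}h : ('C(p.+1.*2, p.+1) = 2 * 'C(p.*2.+1, p))%N.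
  by rewrite doubleS; nia.
rewrite h add1n doubleS natrM (exprS _ p.*2.+1).
by rewrite invfM mulrACA divff ?pnatr_eq0// mul1r.
Qed.

(** The ratio C(n, j+1) / C(n, j) is 1 + (n-2j-1)/(j+1), at most the exponential
    of (n-2j)/(j+1), which decreases in j. *)
Lemma bin_growth n (q : R) i t : (i + t <= n./2)%N ->
  (n%:R - 2 * i%:R) / i.+1%:R <= q ->
  'C(n, i + t)%:R <= 'C(n, i)%:R * expR (t%:R * q).
Proof.
elim: t i => [|t IH] i it iq; first by rewrite addn0 mul0r expR0 mulr1.
have i0 : 0 < i.+1%:R :> R by rewrite ltr0n.
have step : 'C(n, i.+1)%:R <= 'C(n, i)%:R * expR q :> R.
  rewrite -(ler_pM2l i0) -natrM mul_bin_left natrM natrB; last by lia.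
  rewrite mulrC [leRHS]mulrCA ler_wpM2l//.
  apply: (@le_trans _ _ (i.+1%:R * (1 + q))); last first.
    by rewrite ler_pM2l// expR_ge1Dx.
  by move: iq; rewrite ler_pdivrMr// -!natr1; lra.
rewrite addnS -addSn; apply: (le_trans (IH _ _ _)); first by lia.
  apply: le_trans iq; rewrite ler_pdivrMr ?ltr0n// mulrAC ler_pdivlMr//.
  have : 2 * i%:R <= n%:R :> R by rewrite -natrM ler_nat; lia.
  by rewrite -!natr1; have := ler0n R i; nra.
by rewrite -nat1r mulrDl mul1r expRD mulrA ler_wpM2r// expR_ge0.
Qed.

(** At distance K sqrt n from its centre, a binomial mass is the central mass
    divided by at most K sqrt n ratios of consecutive coefficients, each at
    most the exponential of 8K / sqrt n. *)
Lemma smooth_delta_lower n x v (K : R) : 0 < K -> 16 * K ^+ 2 <= n%:R ->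
  `|v%:~R + n%:R / 2 - x%:~R| <= K * Num.sqrt n%:R ->
  expR (- (8 * K ^+ 2)) * Num.sqrt ((2 * n.+1%:R)^-1) <= smooth n (delta x) v.
Proof.
move=> K0 nK.
have n0 : 0 < n%:R :> R by apply: lt_le_trans nK; rewrite mulr_gt0 ?exprn_gt0.
set s := Num.sqrt n%:R.
have s0 : 0 < s by rewrite sqrtr_gt0.
have ss : s ^+ 2 = n%:R by rewrite sqr_sqrtr// ltW.
have Ks : 4 * K <= s.
  by rewrite -ler_sqr ?nnegrE ?(ltW s0) ?mulr_ge0 ?(ltW K0)// ss exprMn -natrX.
have Kn : K * s <= n%:R / 4 by rewrite -ss expr2; nra.
rewrite (_ : v%:~R + _ - _ = n%:R / 2 - (x - v)%:~R); last by rewrite intrB; ring.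
rewrite smooth_deltaE.
case: (x - v) => k; last first.
  by rewrite NegzE mulrNz opprK ler_norml => /andP[_]; have := ler0n R k.+1; lra.
rewrite -pmulrn => hk.
have kn : (k <= n)%N.
  by rewrite -(ler_nat R); move: hk; rewrite ler_norml => /andP[]; lra.
have [i [-> hi ip]] : exists i, [/\ 'C(n, k) = 'C(n, i), `|n%:R / 2 - i%:R| <= K * s &
    (i <= n./2)%N].
  have [ki|ki] := leqP k n./2; first by exists k.
  exists (n - k)%N; rewrite bin_sub//; split=> //; last by lia.
  by rewrite natrB// (_ : _ / 2 - _ = - (n%:R / 2 - k%:R)) ?normrN//; lra.
set t := (n./2 - i)%N.
have := central_mass_lower n.
rewrite -[in 'C(n, _)](subnKC ip) -/t => cl.
have h : 'C(n, i + t)%:R <= 'C(n, i)%:R * expR (t%:R * (8 * K / s)) :> R.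
  apply: bin_growth; first by rewrite subnKC.
  move: hi; rewrite ler_norml => /andP[hi1 hi2].
  rewrite ler_pdivrMr ?ltr0n// mulrAC ler_pdivlMr// -natr1.
  have : n%:R / 4 <= i%:R :> R by lra.
  have := ler0n R i; move: ss; rewrite expr2; nra.
have ht : t%:R * (8 * K / s) <= 8 * K ^+ 2.
  have : t%:R <= K * s.
    rewrite natrB// (le_trans _ hi)// (le_trans _ (ler_norm _))// lerD2r.
    by rewrite ler_pdivlMr// -natrM ler_nat; lia.
  by rewrite mulrA ler_pdivrMr// expr2; nra.
rewrite expRN mulrC ler_pdivrMr ?expR_gt0//.
apply: (le_trans cl); rewrite mulrAC ler_wpM2r ?invr_ge0 ?exprn_ge0//.
by apply: (le_trans h); rewrite ler_wpM2l// ler_expR.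
Qed.

End Smooth.

(** * Steps that charge both 0 and 1 *)

Section SpreadLaws.
Context {R : realType}.
Implicit Types h : int -> R.

(** Written as a lower bound for the atoms, so that a block of steps is again a
    [law]. *)
Definition floor01 (k : R) (x : int) : R := if x \in [:: 0; 1] then k else 0.

Lemma quad_smooth n h : quad h -> quad (smooth n h).
Proof.
move=> qh; elim: n => [//|n IH] /=.
have := quadZ 2^-1 (quadD IH (quad_shiftr 1 IH)).
by under eq_fun do rewrite mulrC.
Qed.

(** The binomial noise is independent of the steps, so both averages commute. *)
Lemma smooth_ev (E : mean_op) n h v : quad h ->
  smooth n (fun z => E (fun y => h (z + y))) v = E (fun y => smooth n h (v + y)).
Proof.
move=> qh; elim: n v => [//|n IH] v /=.
have qs := quad_smooth n qh.
under [in RHS]eq_fun do rewrite mulrC -addrA (addrC _ 1) addrA.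
rewrite evZ; last by apply: quadD; exact: quad_shift.
by rewrite evD; [rewrite !IH mulrC|exact: quad_shift..].
Qed.

Lemma ev_floor01 V k (E : law V (floor01 k)) h : quad h ->
  (forall y, 0 <= h y) -> k * (h 0 + h 1) <= E h.
Proof.
move=> qh h0; apply: le_trans (@ev_ge_atoms _ E [:: 0; 1] (fun=> k) h _ _ _ _) => //.
  by rewrite !big_cons big_nil addr0 mulrDr.
by move=> x xs; apply: le_trans (law_atom E x); rewrite /floor01 xs.
Qed.

(** Discrete supersolution: 1 / sqrt s is convex, so a unit jump made with
    probability 2k decreases it on average at least as much as a deterministic
    shift by k. *)
Lemma inv_sqrt_step (k s : R) : 0 <= k <= 1 -> 1 <= s ->
  (1 - 2 * k) * Num.sqrt (2 / s) + 2 * k * Num.sqrt (2 / (s + 1))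
  <= Num.sqrt (2 / (s + k)).
Proof.
move=> /andP[k0 k1] s1; have s0 : 0 < s by lra.
set w := s^-1; have w0 : 0 < w by rewrite invr_gt0.
have ws : w * s = 1 by rewrite mulVf ?gt_eqF.
have w1 : w <= 1 by rewrite invf_le1.
set p := Num.sqrt (2 * w); have p0 : 0 <= p by rewrite sqrtr_ge0.
have p2 : p ^+ 2 = 2 * w by rewrite sqr_sqrtr; lra.
have hq : Num.sqrt (2 / (s + 1)) <= p * (1 - w / 4).
  rewrite -ler_sqr ?nnegrE ?sqrtr_ge0//; last by rewrite mulr_ge0//; lra.
  rewrite sqr_sqrtr ?divr_ge0//; last by lra.
  rewrite exprMn p2 ler_pdivrMr; last by lra.
  have -> : 2 * w * (1 - w / 4) ^+ 2 * (s + 1) = 2 * (1 - w / 4) ^+ 2 * (w * s + w).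
    by ring.
  by rewrite ws !expr2; nra.
have hr : p * (1 - k * w / 2) <= Num.sqrt (2 / (s + k)).
  have kw : 0 <= k * w <= 1 by nra.
  rewrite -ler_sqr ?nnegrE ?sqrtr_ge0//; last by rewrite mulr_ge0//; lra.
  rewrite sqr_sqrtr ?divr_ge0//; last by lra.
  rewrite exprMn p2 ler_pdivlMr; last by lra.
  have -> : 2 * w * (1 - k * w / 2) ^+ 2 * (s + k) =
      2 * (1 - k * w / 2) ^+ 2 * (w * s + k * w) by ring.
  rewrite ws; move: (k * w) kw => u /andP[u0 u1].
  have u3 : 0 <= 3 - u by lra.
  have := mulr_ge0 (mulr_ge0 u0 u0) u3.
  by rewrite !expr2; nra.
apply: le_trans hr.
have : 2 * k * Num.sqrt (2 / (s + 1)) <= 2 * k * (p * (1 - w / 4)).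
  by rewrite ler_wpM2l// mulr_ge0.
by move/(lerD (lexx ((1 - 2 * k) * p))); move/le_trans; apply; nra.
Qed.

(** A step uses the fair coin with probability 2k, and then increases the number
    [n] of tosses by one; otherwise it only translates the walk, which does not
    change the supremum. The bound is a supersolution of this recursion. *)
Lemma smooth_walk_upper V k (es : seq (law V (floor01 k))) n x v :
  0 < k <= 1 / 2 -> smooth n (walk es (delta x)) v
  <= Num.sqrt (2 / (n.+1%:R + k * (size es)%:R)).
Proof.
move=> /andP[k0 k2]; elim: es n v => [|E es IH] n v.
  by rewrite mulr0 addr0; exact: smooth_delta_upper.
have qg : quad (walk es (delta x)) by exact/quad_walk/quad_delta.
have qs := quad_smooth n qg.
rewrite [walk _ _]/= smooth_ev//.
set s := n.+1%:R + k * (size es)%:R.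
have s1 : 1 <= s by rewrite ler_wpDr ?ler1n// mulr_ge0// ltW.
have hs : 2 / (n.+1%:R + k * (size (E :: es))%:R) = 2 / (s + k).
  by rewrite /s /= -[(size es).+1%:R]natr1 mulrDr mulr1 addrA.
have k01 : 0 <= k <= 1 by apply/andP; split; lra.
rewrite hs; apply: le_trans (inv_sqrt_step k01 s1).
have -> : s + 1 = n.+2%:R + k * (size es)%:R by rewrite /s -[n.+2%:R]natr1; ring.
set F := Num.sqrt (2 / s); set F' := Num.sqrt _.
have F1 u : smooth n (walk es (delta x)) u <= F by exact: IH.
have F2 : smooth n.+1 (walk es (delta x)) v <= F' by exact: IH.
set g := smooth n (walk es (delta x)).
have : k * (F - g (v + 0) + (F - g (v + 1))) <= E (fun y => F - g (v + y)).
  apply: ev_floor01 => [|y]; last by rewrite subr_ge0 F1.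
  by apply: quadB (quad_cst F) (quad_shift v qs).
rewrite addr0 evB; [|exact: quad_cst|exact: quad_shift].
by move: F2; rewrite ev_cst /= -/g; nra.
Qed.

(** The quadratic function on the left is a subsolution of the recursion of the
    number [n] of tosses and of the position [v]. It
    bounds from below the mean of 1 - al (centre - x)^2 - ga (number of tosses - N0)^2
    at the end of the walk, where the centre is the conditional mean [v + n/2] given the steps that do
    not use the coin; its variance is at most that of the walk, and the number
    of tosses has variance at most one per step. *)
Lemma smooth_walk_lower V k (es : seq (law V (floor01 k))) (al ga N0 c : R) x n v :
  0 < k <= 1 / 2 ->
  0 <= al -> 0 <= ga -> 0 <= c ->
  (forall n v, c * (1 - al * (v%:~R + n%:R / 2 - x%:~R) ^+ 2
                   - ga * (n%:R - N0) ^+ 2) <= smooth n (delta x) v) ->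
  c * (1 - al * ((v%:~R + n%:R / 2 + means es - x%:~R) ^+ 2 + variances es)
         - ga * ((n%:R + 2 * k * (size es)%:R - N0) ^+ 2 + (size es)%:R))
  <= smooth n (walk es (delta x)) v.
Proof.
move=> /andP[k0 k2] al0 ga0 c0 base.
rewrite /means /variances.
elim: es n v => [|E es IH] n v.
  by rewrite !big_nil mulr0 !addr0; exact: base.
have qg : quad (walk es (delta x)) by exact/quad_walk/quad_delta.
have qs := quad_smooth n qg.
rewrite [walk _ _]/= smooth_ev// !big_cons [size _]/= -[(size es).+1%:R]natr1.
move: IH; set M := \sum_(E <- es) ev_mean E; set W := \sum_(E <- es) ev_variance E.
set j := (size es)%:R; set g := smooth n (walk es (delta x)) => IH.
pose D := n%:R + 2 * k * j - N0.
pose Q (u : int) := c * (1 - al * ((u%:~R + n%:R / 2 + M - x%:~R) ^+ 2 + W)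
                         - ga * (D ^+ 2 + j)).
have QE : Q = fun u => - (c * al) * (u%:~R + (n%:R / 2 + M - x%:~R)) ^+ 2 +
    c * (1 - al * W - ga * (D ^+ 2 + j)).
  by apply/funext => u; rewrite /Q; ring.
have qQ : quad Q.
  by rewrite QE; apply: quadD (quad_cst _); exact/quadZ/quad_sq.
have EQ : E (fun y => Q (v + y)) =
    c * (1 - al * ((v%:~R + n%:R / 2 + (ev_mean E + M) - x%:~R) ^+ 2 + (ev_variance E + W))
         - ga * (D ^+ 2 + j)).
  rewrite QE; under eq_fun do rewrite intrD (addrC v%:~R) -(addrA _%:~R).
  rewrite ev_linear; [|exact: quad_sq|exact: quad_cst].
  by rewrite ev_sq ev_cst; ring.
have : k * (g (v + 0) - Q (v + 0) + (g (v + 1) - Q (v + 1)))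
    <= E (fun y => g (v + y) - Q (v + y)).
  apply: ev_floor01 => [|y]; last by rewrite subr_ge0; exact: IH.
  by apply: quadB; exact: quad_shift.
rewrite addr0 evB; [|exact: quad_shift..].
have := IH n.+1 v.
rewrite -natr1 [smooth _ _ _]/= -/g => IH1 IH2.
rewrite -subr_ge0 in IH1.
have step : 0 <= 2 * k * ((g v + g (v + 1)) / 2 -
    c * (1 - al * ((v%:~R + (n%:R + 1) / 2 + M - x%:~R) ^+ 2 + W)
           - ga * ((n%:R + 1 + 2 * k * j - N0) ^+ 2 + j))).
  by rewrite mulr_ge0//; lra.
rewrite EQ in IH2.
rewrite -subr_ge0.
have pos : 0 <= c * al * (k / 2) + c * ga * (1 - 2 * k + 4 * k ^+ 2).
  apply: addr_ge0; apply: mulr_ge0; [exact: mulr_ge0|lra|exact: mulr_ge0|].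
  by have := sqr_ge0 k; lra.
have := lerD step IH2; rewrite add0r -subr_ge0 => {}IH2.
apply: (le_trans (addr_ge0 IH2 pos)).
rewrite le_eqVlt; apply/orP; left; apply/eqP.
by rewrite /Q intrD /D; field.
Qed.

Lemma walk_upper V k (es : seq (law V (floor01 k))) x v : 0 < k <= 1 / 2 ->
  walk es (delta x) v <= Num.sqrt (2 / (k * (size es).+1%:R)).
Proof.
move=> k01; apply: le_trans (smooth_walk_upper es 0 x v k01) _.
case/andP: k01 => k0 k2; have j0 := ler0n R (size es).
apply: ler_wsqrtr; rewrite ler_pM2l// lef_pV2 ?posrE ?mulr_gt0 ?ltr0n//.
  by rewrite -natr1; nra.
by rewrite ltr_wpDr// mulr_ge0// ltW.
Qed.

(** With high probability the number of tosses is between k M and 3 k M, M being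
    the number of steps, and the centre of the binomial law is within
    K sqrt (k M) of x. The quadratic lower bound is nonpositive outside of
    this event, so that it is below the binomial mass everywhere. *)
Lemma walk_lower (V k D : R) : 0 < k <= 1 / 2 -> 0 <= V -> 0 <= D ->
  exists (c : R) (M0 : nat), 0 < c /\
  forall (es : seq (law V (floor01 k))) x v, (M0 <= size es)%N ->
    (v%:~R + means es - x%:~R) ^+ 2 <= D * (size es)%:R ->
    c / Num.sqrt (size es)%:R <= walk es (delta x) v.
Proof.
move=> /andP[k0 k2] V0 D0.
(* K2 = K^2 makes the penalty for the position at most 1/2 at the start. *)
have [K2 K20 K2E] : exists2 K2, 0 < K2 & K2 * k = 2 * (D + V + 1).
  exists (2 * (D + V + 1) / k); first by rewrite divr_gt0// mulr_gt0//; lra.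
  by rewrite divfK ?gt_eqF.
have [K K0 KK] : exists2 K, 0 < K & K ^+ 2 = K2.
  by exists (Num.sqrt K2); rewrite ?sqrtr_gt0// sqr_sqrtr// ltW.
have k0' := ltW k0; have K20' := ltW K20.
have t1 : 0 <= 4 / k ^+ 2 by rewrite divr_ge0 ?exprn_ge0.
have t2 : 0 <= 16 * K2 / k by rewrite divr_ge0 ?mulr_ge0.
pose c := expR (- (8 * K2)) * Num.sqrt 5^-1.
have c0 : 0 < c by rewrite mulr_gt0 ?expR_gt0// sqrtr_gt0 invr_gt0.
exists (c / 4), (Num.truncn (4 / k ^+ 2 + 16 * K2 / k)).+1; split; first by rewrite divr_gt0.
move=> es x v hM hv; set M := (size es)%:R : R.
have {hM}hM : 4 / k ^+ 2 + 16 * K2 / k <= M.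
  by apply/ltW/(lt_le_trans (truncnS_gt _)); rewrite ler_nat.
have M1 : 1 <= M.
  rewrite (le_trans _ hM)// -[leLHS]addr0 lerD//.
  by rewrite ler_pdivlMr ?exprn_gt0// mul1r expr2; nra.
have M0 : 0 < M by lra.
have kM0 : 0 < k * M by rewrite mulr_gt0.
have hM1 : 4 <= k ^+ 2 * M.
  by rewrite -ler_pdivrMl ?exprn_gt0// mulrC (le_trans _ hM)// lerDl.
have hM2 : 16 * K2 <= k * M.
  by rewrite -ler_pdivrMl// mulrC (le_trans _ hM)// lerDr.
pose al := (K2 * (k * M))^-1; pose ga := ((k * M) ^+ 2)^-1.
have al0 : 0 <= al by rewrite invr_ge0 mulr_ge0// ltW.
have ga0 : 0 <= ga by rewrite invr_ge0 exprn_ge0// ltW.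
pose c' := expR (- (8 * K2)) * Num.sqrt ((5 * M)^-1).
have c'0 : 0 <= c' by rewrite mulr_ge0 ?expR_ge0 ?sqrtr_ge0.
have base n u : c' * (1 - al * (u%:~R + n%:R / 2 - x%:~R) ^+ 2
                   - ga * (n%:R - 2 * k * M) ^+ 2) <= smooth n (delta x) u.
  set A := u%:~R + _ - _; set B := n%:R - _.
  have [hA|hA] := leP 1 (al * A ^+ 2).
    apply: le_trans (smooth_delta_ge0 _ _ _); rewrite mulr_ge0_le0//.
    by have := mulr_ge0 ga0 (sqr_ge0 B); lra.
  have [hB|hB] := leP 1 (ga * B ^+ 2).
    apply: le_trans (smooth_delta_ge0 _ _ _); rewrite mulr_ge0_le0//.
    by have := mulr_ge0 al0 (sqr_ge0 A); lra.
  apply: (@le_trans _ _ c').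
    rewrite ler_piMr//.
    by have := mulr_ge0 al0 (sqr_ge0 A); have := mulr_ge0 ga0 (sqr_ge0 B); lra.
  have {hB} : `|B| < k * M.
    rewrite -ltr_sqr ?nnegrE ?(ltW kM0)// -normrX ger0_norm ?sqr_ge0//.
    by move: hB; rewrite /ga mulrC ltr_pdivrMr ?mul1r ?exprn_gt0.
  rewrite ltr_norml => /andP[hB1 hB2].
  have n1 : k * M <= n%:R by rewrite /B in hB1; lra.
  have n2 : n%:R <= 3 * (k * M) by rewrite /B in hB2; lra.
  apply: le_trans (@smooth_delta_lower _ n x u K K0 _ _).
  - rewrite KK ler_wpM2l ?expR_ge0//; apply: ler_wsqrtr.
    rewrite lef_pV2 ?posrE ?mulr_gt0// ?ltr0n// -natr1.
    have : k * M <= 1 / 2 * M by rewrite ler_pM2r.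
    by lra.
  - by rewrite KK (le_trans hM2).
  - rewrite -/A -ler_sqr ?nnegrE ?mulr_ge0 ?sqrtr_ge0 ?(ltW K0)//.
    rewrite -normrX ger0_norm ?sqr_ge0// exprMn sqr_sqrtr// KK.
    move: hA; rewrite /al mulrC ltr_pdivrMr ?mulr_gt0// mul1r => /ltW/le_trans; apply.
    by rewrite ler_pM2l.
have := @smooth_walk_lower V k es al ga (2 * k * M) c' x 0 v _ al0 ga0 c'0 base.
rewrite /= => /(_ (introT andP (conj k0 k2))); apply: le_trans.
have -> : c / 4 / Num.sqrt M = c' * (1 / 4).
  rewrite /c /c' invfM sqrtrM ?invr_ge0// (sqrtrV (ltW M0)); ring.
rewrite ler_wpM2l// mul0r addr0 add0r subrr expr0n /= add0r.
have h1 : ga * M <= 1 / 4.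
  rewrite /ga mulrC ler_pdivrMr ?exprn_gt0// exprMn.
  by rewrite (expr2 M); nra.
have h2 : al * ((v%:~R + means es - x%:~R) ^+ 2 + variances es) <= 1 / 2.
  rewrite /al mulrC ler_pdivrMr ?mulr_gt0//.
  have -> : 1 / 2 * (K2 * (k * M)) = (D + V + 1) * M.
    by rewrite (mulrA K2) K2E; field.
  have := variances_le es; rewrite -/M; nra.
by lra.
Qed.

End SpreadLaws.

(** * Local estimates for irreducible aperiodic steps *)

Section Local.
Context {R : realType}.
Implicit Types h : int -> R.

Lemma int_window (p : pred int) (c r : R) : 0 <= r ->
  (forall y, p y -> `|y%:~R - c| <= r) ->
  exists s : seq int, [/\ uniq s, s =i p & (size s)%:R <= 2 * r + 2].
Proof.
move=> r0 pr; pose b := Num.floor (c - r).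
have b1 : b%:~R <= c - r by exact: floor_le_tmp.
have b2 : c - r < b%:~R + 1 by rewrite -(intrD _ b 1) floorD1_gt.
have [N N1 N2] : exists2 N : nat, N%:R <= 2 * r + 2 & 2 * r + 1 < N%:R.
  exists (Num.truncn (2 * r) + 2)%N; rewrite natrD.
    have : (Num.truncn (2 * r))%:R <= 2 * r by rewrite truncn_le mulr_ge0.
    by lra.
  by have := truncnS_gt (2 * r); rewrite -natr1; lra.
exists [seq y <- [seq b + k%:Z | k <- iota 0 N] | p y]; split.
- by rewrite filter_uniq// map_inj_uniq ?iota_uniq// => i j /addrI[].
- move=> y; rewrite mem_filter [RHS]unfold_in; case: (boolP (p y)) => //= py.
  have := pr _ py; rewrite ler_norml => /andP[h1 h2].
  have yb : b <= y by rewrite -(ler_int R); lra.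
  apply/mapP; exists `|y - b|%N; last by rewrite gez0_abs ?subr_ge0//; ring.
  rewrite mem_iota /= add0n -(ltr_nat R) natr_absz ger0_norm ?subr_ge0//.
  by rewrite intrB; lra.
- rewrite size_filter (le_trans _ N1)// ler_nat (leq_trans (count_size _ _))//.
  by rewrite size_map size_iota.
Qed.

Section Lump.
Variables (V : R) (a : int -> R) (es : seq (law V a)).

Definition lump : mean_op (R := R) :=
  @MeanOp R (fun h => walk es h 0) (walk_cst es 1 0)
    (fun r h g qh qg => walk_linear es r 0 qh qg)
    (fun h qh hge => walk_ge0 es 0 qh hge).

Lemma mean_lump : ev_mean lump = means es.
Proof. by rewrite /ev_mean /= walk_id add0r. Qed.

Lemma variance_lump : ev_variance lump = variances es.
Proof.
rewrite /ev_variance mean_lump /=.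
have := walk_sq es 0 0; rewrite add0r subr0.
by under eq_fun do rewrite subr0; move=> ->; rewrite addrAC subrr add0r.
Qed.

Lemma walk_lump h z : walk es (fun y => h (z + y)) 0 = walk es h z.
Proof. by rewrite -walk_shift addr0. Qed.

End Lump.

(** The laws of a list may all differ, hence the uniformity over all blocks. The
    lengths up to [L.*2] are needed to cut a list into blocks without
    remainder. *)
Definition spreads V a L (k : R) :=
  [/\ (0 < L)%N, 0 < k <= 1 / 2, 0 <= V & forall es : seq (law V a),
    (L <= size es < L.*2)%N ->
    k <= walk es (delta 0) 0 /\ k <= walk es (delta 1) 0].

Section Spreads.
Variables (V : R) (a : int -> R) (L : nat) (k : R).
Hypothesis Lk : spreads V a L k.

Lemma exists_lump (es : seq (law V a)) : (L <= size es < L.*2)%N ->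
  exists E : law (V * L.*2%:R) (floor01 k), ev_mean E = means es /\
    forall h z, E (fun y => h (z + y)) = walk es h z.
Proof.
case: Lk => _ _ V0 spr sz; have [s0 s1] := spr _ sz.
have vle : ev_variance (lump es) <= V * L.*2%:R.
  rewrite variance_lump (le_trans (variances_le es))// ler_wpM2l// ler_nat.
  by case/andP: sz => _ /ltnW.
have atom x : floor01 k x <= lump es (delta x).
  rewrite /floor01 /= !inE; case: eqP => [->//|_]; case: eqP => [->//|_] /=.
  apply: walk_ge0; first exact: quad_delta.
  by move=> y; rewrite /delta ler0n.
exists (Law vle atom); split; first exact: mean_lump.
by move=> h z; exact: walk_lump.
Qed.

Lemma exists_lumps M (es : seq (law V a)) : (0 < M)%N ->
  (M * L <= size es < M.+1 * L)%N ->
  exists bs : seq (law (V * L.*2%:R) (floor01 k)),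
    [/\ size bs = M, means bs = means es & forall h z, walk bs h z = walk es h z].
Proof.
case: M => // M _; elim: M es => [|M IH] es.
  rewrite mul1n mul2n => sz; have [E [mE wE]] := exists_lump sz.
  exists [:: E]; split=> //; by rewrite /means big_seq1.
have [L0 _ _ _] := Lk.
move=> sz; have Lsz : (L <= size es)%N by lia.
have st : size (take L es) = L by rewrite size_takel.
have [|E [mE wE]] := @exists_lump (take L es); first by rewrite st; lia.
have [|bs [sb mb wb]] := IH (drop L es); first by rewrite size_drop; lia.
exists (E :: bs); split; first by rewrite /= sb.
- by rewrite /means big_cons -/(means bs) mb mE -means_cat cat_take_drop.
- move=> h z; rewrite -(cat_take_drop L es) walk_cat -wE /=.
  by congr (ev E _); apply/funext => y; exact: wb.
Qed.

Lemma lumps_count (es : seq (law V a)) : let M := (size es %/ L)%N in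
  (L <= size es)%N -> (0 < M)%N /\ (M * L <= size es < M.+1 * L)%N.
Proof.
have [L0 _ _ _] := Lk.
by move=> M Le; rewrite divn_gt0// Le leq_divM ltn_ceil.
Qed.

Lemma local_upper : exists2 C, 0 < C & forall (es : seq (law V a)) x z,
  walk es (delta x) z <= C / Num.sqrt (size es).+1%:R.
Proof.
have [L0 k01 _ _] := Lk; have /andP[k0 k2] := k01.
have LR : 0 < L%:R :> R by rewrite ltr0n.
exists (Num.sqrt (2 * L%:R / k)); first by rewrite sqrtr_gt0 divr_gt0 ?mulr_gt0.
move=> es x z.
have s0 : 0 < (size es).+1%:R :> R by rewrite ltr0n.
rewrite -(sqrtrV (ltW s0)) -sqrtrM; last by rewrite divr_ge0 ?mulr_ge0 ?ltW.
have [Le|Lg] := leqP L (size es).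
  have [M0 /andP[M1 M2]] := lumps_count Le.
  have [|bs [sb _ <-]] := exists_lumps M0 (es := es); first by rewrite M1 M2.
  apply: le_trans (walk_upper bs x z k01) _; apply: ler_wsqrtr; rewrite sb.
  rewrite invfM mulrA ler_pdivrMr ?ltr0n//.
  have -> : 2 * L%:R / k / (size es).+1%:R * ((size es) %/ L).+1%:R =
    2 / k * (((size es) %/ L).+1%:R * L%:R / (size es).+1%:R) by ring.
  rewrite ler_peMr ?divr_ge0 ?(ltW k0)// ler_pdivlMr// mul1r -natrM ler_nat.
  exact: M2.
apply: (@le_trans _ _ 1).
  apply: walk_le1; first exact: quad_delta.
  by move=> y; rewrite /delta lern1 leq_b1.
rewrite -[leLHS]sqrtr1; apply: ler_wsqrtr; rewrite ler_pdivlMr// mul1r.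
have Ls : (size es).+1%:R <= L%:R :> R by rewrite ler_nat.
by rewrite ler_pdivlMr//; nra.
Qed.

Lemma local_lower (D : R) : 0 <= D -> exists2 c, 0 < c & exists n0 : nat,
  forall (es : seq (law V a)) x z, (n0 <= size es)%N ->
  (z%:~R + means es - x%:~R) ^+ 2 <= D * (size es)%:R ->
  c / Num.sqrt (size es)%:R <= walk es (delta x) z.
Proof.
move=> D0; have [L0 k01 V0 _] := Lk.
have [] := @walk_lower R (V * L.*2%:R) k (D * L.*2%:R) k01.
- by rewrite mulr_ge0.
- by rewrite mulr_ge0.
move=> c [M0 [c0 low]]; exists c => //; exists (maxn L (M0 * L)) => es x z.
rewrite geq_max => /andP[Le M0e] hx.
have [Mp /andP[M1 M2]] := lumps_count Le.
have [|bs [sb mb wb]] := exists_lumps Mp (es := es); first by rewrite M1 M2.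
rewrite -wb; apply: le_trans (low _ x z _ _).
- rewrite sb ler_wpM2l ?(ltW c0)// lef_pV2 ?posrE ?sqrtr_gt0 ?ltr0n ?(leq_trans L0 Le) ?Mp//.
  by apply: ler_wsqrtr; rewrite ler_nat leq_div.
- by rewrite sb leq_divRL.
- rewrite mb sb (le_trans hx)// -mulrA ler_wpM2l// -natrM ler_nat; nia.
Qed.

(** One of the two halves of the walk deviates by at least d/2 from its mean. If
    it is the first one, the second one provides the factor 1 / sqrt n. If it
    is the second one, the middle position ranges over a finite window; its law
    is bounded by C / sqrt n at each point, and summing the second half over
    the window gives a probability of deviation. *)
Lemma local_tail : exists2 C, 0 < C & forall (es : seq (law V a)) x z d,
  0 < d -> d <= `|z%:~R + means es - x%:~R| ->
  walk es (delta x) z <= C * Num.sqrt (size es).+1%:R / d ^+ 2.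
Proof.
have [_ _ V0 _] := Lk; have [C C0 up] := local_upper.
exists (C * Num.sqrt 2 * (4 * V) + 1).
  by rewrite ltr_wpDl// !mulr_ge0 ?sqrtr_ge0 ?(ltW C0).
move=> es x z d d0 hd.
set n := size es.
pose es1 := take n./2 es; pose es2 := drop n./2 es.
pose S := C * Num.sqrt 2 / Num.sqrt n.+1%:R.
have S0 : 0 <= S by rewrite divr_ge0 ?mulr_ge0 ?sqrtr_ge0 ?(ltW C0).
have half (l : seq (law V a)) y u : (n <= (size l).*2.+1)%N -> walk l (delta y) u <= S.
  move=> nl; apply: le_trans (up _ _ _) _; rewrite /S -mulrA ler_wpM2l ?(ltW C0)//.
  rewrite ler_pdivlMr ?sqrtr_gt0 ?ltr0n// mulrC ler_pdivrMr ?sqrtr_gt0 ?ltr0n//.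
  by rewrite -sqrtrM// ler_wsqrtr// -natrM ler_nat; lia.
have half1 y u : walk es1 (delta y) u <= S.
  by apply: half; rewrite size_takel /n; lia.
have half2 y u : walk es2 (delta y) u <= S.
  by apply: half; rewrite size_drop /n; lia.
pose m1 := z%:~R + means es1.
pose close_by y := `|y%:~R - m1| < d / 2.
have me : means es = means es1 + means es2 by rewrite -means_cat cat_take_drop.
have [|s [us sE' _]] := @int_window close_by m1 (d / 2) _ (fun y => @ltW _ _ _ _).
  by rewrite divr_ge0// ltW.
have sE y : (y \in s) = close_by y by exact: sE'.
pose g := walk es2 (delta x).
have qg : quad g by exact/quad_walk/quad_delta.
have g0 y : 0 <= g y by apply: walk_ge0 => [|u]; [exact: quad_delta|rewrite /delta ler0n].
have split_walk : walk es (delta x) z =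
    walk es1 (fun y => \sum_(u <- s) g u * delta u y) z +
    walk es1 (fun y => if close_by y then 0 else g y) z.
  rewrite -[es in LHS](cat_take_drop n./2) walk_cat -walkD.
  - congr (walk _ _ z); apply/funext => y; rewrite sum_deltaE// sE.
    by case: ifP => _; rewrite ?mul1r ?mul0r ?addr0 ?add0r.
  - by apply: quad_sum => u; exact/quadZ/quad_delta.
  - by apply: quad_if => //; exact: quad_cst.
have d2 : 0 < d / 2 by rewrite divr_gt0.
have far : walk es1 (fun y => if close_by y then 0 else g y) z <=
    S * (4 * variances es1 / d ^+ 2).
  apply: (@le_trans _ _ (walk es1 (fun y => S * (if close_by y then 0 else 1)) z)).
    apply: walk_le.
    - by apply: quad_if => //; exact: quad_cst.
    - by apply: quadZ; apply: quad_if; exact: quad_cst.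
    - by move=> y; case: ifP => _; rewrite ?mulr0 ?mulr1//; exact: half2.
  rewrite walkZ; last by apply: quad_if; exact: quad_cst.
  rewrite ler_wpM2l//.
  apply: le_trans (@walk_chebyshev _ _ _ _ _ m1 (d / 2) _ d2 _ _) _.
  - by move=> y; case: ifP => _; rewrite ?lexx ?ler01.
  - by move=> y; rewrite /close_by; case: ltP => //; rewrite eqxx.
  - rewrite /m1 subrr expr0n add0r expr_div_n invf_div mulrCA mulrA.
    by rewrite -natrX.
have close : walk es1 (fun y => \sum_(u <- s) g u * delta u y) z <=
    S * (4 * variances es2 / d ^+ 2).
  rewrite walk_sum; last by move=> u; exact/quadZ/quad_delta.
  apply: (@le_trans _ _ (S * \sum_(u <- s) g u)).
    rewrite mulr_sumr; apply: ler_sum => u _.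
    rewrite walkZ; last exact: quad_delta.
    by rewrite mulrC ler_wpM2r.
  rewrite ler_wpM2l//.
  have -> : \sum_(u <- s) g u = walk es2 (fun y => \sum_(u <- s) delta x (u + y)) 0.
    rewrite walk_sum; last by move=> u; exact/quad_shift/quad_delta.
    by apply: eq_bigr => u _; rewrite -walk_shift addr0.
  have indE y : \sum_(u <- s) delta x (u + y) = (close_by (x - y))%:R :> R.
    transitivity (\sum_(u <- s) (1 : R) * delta u (x - y)).
      by apply: eq_bigr => u _; rewrite mul1r /delta subr_eq eq_sym.
    by rewrite sum_deltaE// sE mulr1.
  under eq_fun do rewrite indE.
  apply: le_trans (@walk_chebyshev _ _ _ _ _ (means es2) (d / 2) _ d2 _ _) _.
  - by move=> y; rewrite ler0n lern1 leq_b1.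
  - move=> y; rewrite pnatr_eq0 eqb0 negbK /close_by intrB => hy.
    have := ler_normD (x%:~R - y%:~R - m1) (y%:~R - means es2).
    rewrite (_ : _ + _ = - (z%:~R + means es - x%:~R)).
      by rewrite normrN; lra.
    by rewrite me /m1; ring.
  - rewrite add0r subrr expr0n add0r expr_div_n invf_div mulrCA mulrA.
    by rewrite -natrX.
rewrite split_walk (le_trans (lerD close far))// -mulrDr -mulrDl -mulrDr.
have -> : variances es2 + variances es1 = variances es.
  by rewrite addrC /variances -big_cat cat_take_drop.
have s0 : 0 < Num.sqrt n.+1%:R :> R by rewrite sqrtr_gt0 ltr0n.
have ss : Num.sqrt n.+1%:R ^+ 2 = n.+1%:R :> R by rewrite sqr_sqrtr.
rewrite mulrA ler_pM2r ?invr_gt0 ?exprn_gt0//.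
apply: (@le_trans _ _ (S * (4 * (V * Num.sqrt n.+1%:R ^+ 2)))).
  rewrite ler_wpM2l// ler_wpM2l// ss (le_trans (variances_le _))//.
  by rewrite ler_wpM2l// ler_nat.
have Sq : S * Num.sqrt n.+1%:R = C * Num.sqrt 2 by rewrite divfK// gt_eqF.
by rewrite -Sq; nra.
Qed.

End Spreads.
End Local.

(** * The walk killed outside a strip *)

Section Kill.
Context {R : realType}.
Implicit Types h : int -> R.
Variables (V : R) (a : int -> R).
Implicit Types es : seq (law V a).

(** The strip is centred at the running mean, which starts from [c]. The starting
    point is tested as well, which makes the killed walk vanish outside the
    strip and turns concatenation into composition. *)
Fixpoint kill (lam c : R) es h (z : int) : R :=
  if `|z%:~R - c| <= lam then
    if es is E :: es' then E (fun y => kill lam (c + ev_mean E) es' h (z + y))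
    else h z
  else 0.

Lemma quad_kill lam c es h : quad h -> quad (kill lam c es h).
Proof.
move=> qh; elim: es c => [|E es IH] c /=.
  by apply: quad_if => //; exact: quad_cst.
by apply: quad_if; [exact/quad_ev/IH|exact: quad_cst].
Qed.

Lemma kill_le lam c es h g z : quad h -> quad g -> (forall y, h y <= g y) ->
  kill lam c es h z <= kill lam c es g z.
Proof.
move=> qh qg hg; elim: es c z => [|E es IH] c z /=; case: ifP => // _.
by apply: ev_le => [||y]; [exact/quad_shift/quad_kill..|exact: IH].
Qed.

Lemma kill_ge0 lam c es h z : quad h -> (forall y, 0 <= h y) ->
  0 <= kill lam c es h z.
Proof.
move=> qh h0; elim: es c z => [|E es IH] c z /=; case: ifP => // _.
by apply: ev_ge0 => [|y]; [exact/quad_shift/quad_kill|exact: IH].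
Qed.

Lemma killZ lam c es r h z : quad h ->
  kill lam c es (fun y => r * h y) z = r * kill lam c es h z.
Proof.
move=> qh; elim: es c z => [|E es IH] c z /=; case: ifP => _; rewrite ?mulr0//.
rewrite -evZ; last exact/quad_shift/quad_kill.
by congr (ev E _); apply/funext => y.
Qed.

Lemma kill_cat lam c es1 es2 h z : kill lam c (es1 ++ es2) h z =
  kill lam c es1 (kill lam (c + means es1) es2 h) z.
Proof.
elim: es1 c z => [|E es1 IH] c z.
  rewrite /means big_nil addr0 /=.
  by case: es2 => [|E es2] /=; case: ifP => // ->.
rewrite /= /means big_cons -/(means es1) addrA; case: ifP => // _.
by congr (ev E _); apply/funext => y.
Qed.

Lemma kill_le_walk lam c es h z : quad h -> (forall y, 0 <= h y) ->
  kill lam c es h z <=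
  walk es (fun y => if `|y%:~R - (c + means es)| <= lam then h y else 0) z.
Proof.
move=> qh h0; elim: es c z => [|E es IH] c z.
  by rewrite /means big_nil addr0.
have qi u : quad (fun y : int => if `|y%:~R - u| <= lam then h y else 0).
  by apply: quad_if => //; exact: quad_cst.
rewrite /means big_cons -/(means es) addrA /=.
case: ifP => _; last first.
  apply: ev_ge0 => [|y]; first exact/quad_shift/quad_walk.
  by apply: walk_ge0 => // u; case: ifP.
apply: ev_le => [||y]; [exact/quad_shift/quad_kill|exact/quad_shift/quad_walk|].
exact: IH.
Qed.

(** The loss is due to the paths that leave the strip. By the Markov property at
    the first exit, it is at most the supremum of the free walk started from
    outside the strip at any intermediate time. *)
Lemma kill_ge_walk lam c es h z B : quad h -> 0 <= B ->
  (forall es1 es2 y, es = es1 ++ es2 -> lam < `|y%:~R - (c + means es1)| ->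
     walk es2 h y <= B) ->
  walk es h z - B <= kill lam c es h z.
Proof.
move=> qh B0; elim: es c z => [|E es IH] c z hB.
  rewrite /=; case: ifP => [_|/negbT]; [by lra|rewrite -ltNge => zc].
  by rewrite subr_le0; apply: (hB [::] [::]) => //; rewrite /means big_nil addr0.
rewrite [kill _ _ _ _ _]/=; case: ifP => [_|/negbT]; last first.
  rewrite -ltNge => zc.
  by rewrite subr_le0; apply: (hB [::] (E :: es)); rewrite // /means big_nil addr0.
rewrite /= -[X in _ - X](ev_cst E B) -evB; [|exact/quad_shift/quad_walk|exact: quad_cst].
apply: ev_le => [||y].
- by apply: quadB (quad_cst _); exact/quad_shift/quad_walk.
- exact/quad_shift/quad_kill.
- apply: IH => es1 es2 u ees cu; apply: (hB (E :: es1)); first by rewrite ees.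
  by rewrite /means big_cons addrA.
Qed.

End Kill.

(** * Mass of the surviving paths *)

Section KillBounds.
Context {R : realType}.
Variables (V : R) (a : int -> R) (L : nat) (k : R).
Hypothesis Lk : spreads V a L k.

(** Each block of [m] steps, [m] of order lam^2, loses at least one half of the
    mass, and the final lam^2 steps give the local factor C / lam. *)
Lemma kill_delta_upper : exists C c : R, [/\ 0 < C, 0 < c &
  forall (es : seq (law V a)) x z (lam : R),
    1 <= lam -> lam ^+ 2 <= (size es)%:R ->
    kill lam 0 es (delta x) z <=
    C / lam * expR (- (c * (size es)%:R / lam ^+ 2))].
Proof.
have [C C0 up] := local_upper Lk.
have qd x : quad (@delta R x) by exact: quad_delta.
pose A := 64 * C ^+ 2 + 2.
have A0 : 0 < A by rewrite ltr_wpDl// mulr_ge0// sqr_ge0.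
exists (C * expR 1), (1 / (2 * A)); split.
- by rewrite mulr_gt0// expR_gt0.
- by rewrite divr_gt0// mulr_gt0.
move=> es x z lam lam1; have lam0 : 0 < lam by lra.
(* sqrt m >= 8 C lam makes the window of at most 4 lam points lose one half. *)
have [m [m1 m2 m3]] : exists m : nat, [/\ lam ^+ 2 <= m%:R,
    (8 * C * lam) ^+ 2 <= m%:R & m%:R <= A * lam ^+ 2].
  pose t := (64 * C ^+ 2 + 1) * lam ^+ 2.
  have l1 : 1 <= lam ^+ 2 by rewrite expr_ge1// ltW.
  have C2 := sqr_ge0 C.
  have t1 : t < (Num.truncn t).+1%:R := truncnS_gt t.
  have t2 : (Num.truncn t)%:R <= t by rewrite truncn_le mulr_ge0 ?sqr_ge0//; lra.
  exists (Num.truncn t).+1; split.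
  - by apply/ltW/(le_lt_trans _ t1); rewrite /t; nra.
  - by apply/ltW/(le_lt_trans _ t1); rewrite /t !exprMn -natrX; nra.
  - by rewrite -natr1 /A; move: t2; rewrite /t; nra.
have claim q : forall (es : seq (law V a)) c z,
    lam ^+ 2 + q%:R * m%:R <= (size es)%:R ->
    kill lam c es (delta x) z <= 2^-1 ^+ q * (C / lam).
  have d0 y : 0 <= delta x y :> R by rewrite /delta ler0n.
  elim: q => [|q IH] {}es c {}z.
    rewrite mul0r addr0 mul1r => sz.
    apply: (le_trans (kill_le_walk _ _ _ _ (qd x) d0)).
    apply: (@le_trans _ _ (walk es (delta x) z)).
      apply: walk_le => //; first by apply: quad_if => //; exact: quad_cst.
      by move=> y; case: ifP.
    apply: (le_trans (up _ _ _)); rewrite ler_pM2l// lef_pV2 ?posrE ?sqrtr_gt0 ?ltr0n//.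
    rewrite -[lam]ger0_norm ?(ltW lam0)// -sqrtr_sqr ler_wsqrtr//.
    by rewrite (le_trans sz)// ler_nat.
  rewrite -natr1 mulrDl mul1r => sz.
  have msz : (m <= size es)%N.
    rewrite -(ler_nat R) (le_trans _ sz)//.
    by have := sqr_ge0 lam; have := mulr_ge0 (ler0n R q) (ler0n R m); lra.
  rewrite -(cat_take_drop m es) kill_cat.
  set es1 := take m es; set es2 := drop m es; set c' := c + means es1.
  set w := 2^-1 ^+ q * (C / lam).
  have w0 : 0 <= w.
    by rewrite mulr_ge0 ?exprn_ge0 ?invr_ge0 ?divr_ge0 ?(ltW C0) ?(ltW lam0).
  have hw y : kill lam c' es2 (delta x) y <= w.
    by apply: IH; rewrite size_drop natrB//; lra.
  have wS : 2^-1 ^+ q.+1 * (C / lam) = w / 2 by rewrite /w exprSr; ring.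
  clearbody w.
  have [|s [us sE ss]] := @int_window R (fun y => `|y%:~R - c'| <= lam) c' lam _ (fun y => id).
    by rewrite ltW.
  have inE y : (y \in s) = (`|y%:~R - c'| <= lam) by exact: sE.
  apply: le_trans (kill_le_walk _ _ _ _ (quad_kill _ _ _ (qd x)) _) _.
    by move=> y; exact: kill_ge0.
  apply: (@le_trans _ _ (walk es1 (fun y => \sum_(g <- s) w * delta g y) z)).
    apply: walk_le.
    - by apply: quad_if; [exact: quad_kill|exact: quad_cst].
    - by apply: quad_sum => g; exact/quadZ/qd.
    - move=> y; rewrite (@sum_deltaE R s (fun=> w))// inE; case: ifP => _.
        by rewrite mul1r.
      by rewrite mul0r.
  rewrite walk_sum; last by move=> g; exact/quadZ/qd.
  have sm : (size es1 = m) by rewrite size_takel.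
  apply: (@le_trans _ _ (\sum_(g <- s) w * (C / Num.sqrt m.+1%:R))).
    apply: ler_sum => g _; rewrite walkZ; last exact: qd.
    by rewrite ler_wpM2l// -sm; exact: up.
  rewrite wS big_const_seq count_predT iter_addr_0.
  rewrite -[_ *+ size s]mulr_natr -mulrA ler_wpM2l//.
  rewrite mulrAC ler_pdivrMr ?sqrtr_gt0 ?ltr0n//.
  have h1 : 8 * C * lam <= Num.sqrt m.+1%:R.
    rewrite -[leLHS]ger0_norm ?mulr_ge0 ?(ltW C0) ?(ltW lam0)// -sqrtr_sqr.
    by rewrite ler_wsqrtr// (le_trans m2)// ler_nat.
  have : C * (size s)%:R <= C * (4 * lam) by rewrite ler_wpM2l ?(ltW C0)//; lra.
  lra.
move=> sz.
have m0 : 0 < m%:R :> R by apply: lt_le_trans m1; rewrite exprn_gt0.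
pose q := Num.truncn (((size es)%:R - lam ^+ 2) / m%:R).
have q1 : q%:R <= ((size es)%:R - lam ^+ 2) / m%:R.
  by rewrite truncn_le divr_ge0 ?subr_ge0.
have q2 : ((size es)%:R - lam ^+ 2) / m%:R < q%:R + 1.
  by rewrite natr1; exact: truncnS_gt.
apply: (le_trans (claim q es 0 z _)).
  by move: q1; rewrite ler_pdivlMr//; lra.
rewrite mulrC -!mulrA ler_pM2l// [leRHS]mulrCA ler_wpM2l ?invr_ge0 ?(ltW lam0)//.
have half : 2^-1 <= expR (- 2^-1) :> R.
  by apply: le_trans (expR_ge1Dx _); lra.
apply: (@le_trans _ _ (expR (- 2^-1) ^+ q)).
  by rewrite lerXn2r ?nnegrE ?invr_ge0 ?expR_ge0.
rewrite -expRM_natl -expRD ler_expR.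
(* The number q of complete blocks is at least n/m - 2. *)
have : (size es)%:R / (A * lam ^+ 2) <= q%:R + 2.
  apply: (@le_trans _ _ ((size es)%:R / m%:R)).
    by rewrite ler_wpM2l// lef_pV2 ?posrE ?mulr_gt0 ?exprn_gt0.
  move: q2; rewrite !ltr_pdivrMr// ler_pdivrMr//; nra.
rewrite mul1r (_ : (2 * A)^-1 * _ = (size es)%:R / (A * lam ^+ 2) / 2).
  by rewrite mulrN; lra.
by field; rewrite !gt_eqF ?exprn_gt0.
Qed.

(** Within a time of order r^2, a walk that has left the strip needs to come back
    over a distance A r to reach the set [s]; for A large this is less likely
    than one half of the local probability c / r. *)
Lemma kill_block : exists (c2 A : R) (r0 : nat), [/\ 0 < c2, 0 < A, (0 < r0)%N &
  forall (r : nat) (es : seq (law V a)) (lam c : R) z (s : seq int),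
    (r0 <= r)%N -> (r * r <= size es < 2 * (r * r))%N ->
    (forall g, g \in s ->
       `|z%:~R + means es - g%:~R| <= 5 * r%:R /\
       `|g%:~R - (c + means es)| + A * r%:R <= lam) ->
    (size s)%:R * (c2 / r%:R) <=
    kill lam c es (fun y => \sum_(g <- s) delta g y) z].
Proof.
have [C C0 tail] := local_tail Lk.
have [c1 c10 [n0 low]] := local_lower Lk (ler0n R 25).
(* A^2 >= A >= 8 C / c1 makes the tail bound 2 C / (A^2 r) at most c1 / (4 r). *)
pose A := 8 * C / c1 + 1.
have A0 : 0 < A by rewrite ltr_wpDl// divr_ge0 ?mulr_ge0 ?ltW.
exists (c1 / 4), A, n0.+1; split=> //; first by rewrite divr_gt0.
move=> r es lam c z s rn /andP[sz1 sz2] hs.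
have rn0 : (0 < r)%N by lia.
have r0 : 0 < r%:R :> R by rewrite ltr0n.
have qd g : quad (@delta R g) by exact: quad_delta.
have qh : quad (fun y => \sum_(g <- s) @delta R g y) by exact: quad_sum.
have srr : Num.sqrt (2 * (r * r))%:R <= 2 * r%:R :> R.
  rewrite -[leRHS]ger0_norm ?mulr_ge0// -sqrtr_sqr ler_wsqrtr//.
  by rewrite exprMn -!natrX -natrM ler_nat; lia.
have sz0 : (0 < size es)%N by move: r0; rewrite ltr0n; nia.
apply: (@le_trans _ _ (walk es (fun y => \sum_(g <- s) delta g y) z -
                       (size s)%:R * (c1 / 4 / r%:R))).
  rewrite lerBrDr walk_sum//.
  apply: (@le_trans _ _ (\sum_(g <- s) c1 / (2 * r%:R))).
    rewrite big_const_seq count_predT iter_addr_0 -[(c1 / (2 * r%:R)) *+ _]mulr_natl.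
    rewrite -mulrDr ler_wpM2l//.
    by rewrite le_eqVlt; apply/orP; left; apply/eqP; field; rewrite gt_eqF.
  rewrite !big_seq; apply: ler_sum => g gs; have [hg _] := hs _ gs.
  apply: le_trans (low es g z _ _); last first.
  - rewrite -ler_sqrt ?mulr_ge0// sqrtr_sqr (le_trans hg)//.
    have -> : 5 * r%:R = Num.sqrt ((5 * r%:R) ^+ 2) :> R.
      by rewrite sqrtr_sqr ger0_norm// mulr_ge0.
    rewrite ler_wsqrtr// exprMn -!natrX -!natrM ler_nat; nia.
  - by rewrite (leq_trans _ sz1)//; nia.
  - rewrite ler_wpM2l ?(ltW c10)// lef_pV2 ?posrE ?mulr_gt0 ?sqrtr_gt0 ?ltr0n//.
    by apply: le_trans srr; rewrite ler_wsqrtr// ler_nat; lia.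
apply: kill_ge_walk => //.
  by rewrite mulr_ge0 ?divr_ge0 ?(ltW c10).
move=> es1 es2 y ees hy.
rewrite walk_sum//.
apply: (@le_trans _ _ (\sum_(g <- s) c1 / 4 / r%:R)); last first.
  by rewrite big_const_seq count_predT iter_addr_0 -[(c1 / 4 / r%:R) *+ _]mulr_natl.
rewrite !big_seq; apply: ler_sum => g gs; have [_ hg] := hs _ gs.
have Ar : 0 < A * r%:R by rewrite mulr_gt0.
apply: (le_trans (tail es2 g y (A * r%:R) Ar _)).
  have := ler_normD (y%:~R + means es2 - g%:~R) (g%:~R - (c + means es)).
  have -> : y%:~R + means es2 - g%:~R + (g%:~R - (c + means es)) =
      y%:~R - (c + means es1) by rewrite ees means_cat; ring.
  by lra.
have s2 : (size es2 < 2 * (r * r))%N.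
  by apply: leq_ltn_trans sz2; rewrite ees size_cat leq_addl.
have h1 : Num.sqrt (size es2).+1%:R <= 2 * r%:R :> R.
  by apply: le_trans srr; rewrite ler_wsqrtr// ler_nat.
rewrite ler_pdivrMr ?exprn_gt0//.
apply: (@le_trans _ _ (C * (2 * r%:R))); first by rewrite ler_wpM2l ?(ltW C0).
have -> : c1 / 4 / r%:R * (A * r%:R) ^+ 2 = c1 / 4 * A ^+ 2 * r%:R.
  by field; rewrite gt_eqF.
rewrite mulrA ler_wpM2r//.
have A1 : 1 <= A by rewrite lerDr divr_ge0 ?mulr_ge0 ?ltW.
have Ac : c1 * A = 8 * C + c1 by rewrite /A; field; rewrite gt_eqF.
apply: (@le_trans _ _ (c1 / 4 * A)); first by rewrite mulrAC Ac; lra.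
by rewrite ler_wpM2l ?divr_ge0 ?(ltW c10)// expr2 ler_peMr// ltW.
Qed.

(** The target moves from [p] to the final point at constant speed, by at most r
    per block. Summing over the r points next to the target at the end of a
    block gives a probability bounded from below, independently of r. *)
Lemma kill_delta_lower (eps : R) : 0 < eps <= 1 -> exists C c lam0 : R,
  [/\ 0 < C, 0 < c, 0 < lam0 &
  forall (es : seq (law V a)) x (lam : R),
    lam0 <= lam -> lam ^+ 2 <= (size es)%:R ->
    `|x%:~R - means es| <= (1 - eps) * lam ->
    1 / (C * lam) * expR (- (c * (size es)%:R / lam ^+ 2)) <=
    kill lam 0 es (delta x) 0].
Proof.
move=> /andP[eps0 eps1].
have [c2 [A [r0 [c20 A0 r00 block]]]] := kill_block.
have qd g : quad (@delta R g) by exact: quad_delta.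
have chain (r : nat) (lam P : R) x : (r0 <= r)%N -> P + (A + 2) * r%:R <= lam ->
   forall N (es : seq (law V a)) (c p : R) z, (0 < N)%N ->
   (N * (r * r) <= size es < N.+1 * (r * r))%N ->
   `|z%:~R - c - p| <= 2 * r%:R -> `|p| <= P ->
   `|x%:~R - (c + means es)| <= P ->
   `|x%:~R - (c + means es) - p| <= N%:R * r%:R ->
   c2 ^+ N / r%:R <= kill lam c es (delta x) z.
  move=> rr hP.
  have rp : 0 < r%:R :> R by rewrite ltr0n (leq_trans r00).
  have r1 : 1 <= r%:R :> R by rewrite ler1n (leq_trans r00).
  case=> // N; elim: N => [|N IH] es c p z _ sz hz hp hx hxp.
    have := block r es lam c z [:: x] rr.
    rewrite mul1r expr1.
    under eq_fun do rewrite big_seq1.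
    apply; first by move: sz; rewrite mul1n.
    move=> g; rewrite inE => /eqP ->; split; last by lra.
    have := ler_normB (z%:~R - c - p) (x%:~R - (c + means es) - p).
    rewrite (_ : _ - _ = z%:~R + means es - x%:~R); last by ring.
    by lra.
  have rrn : (r * r <= size es)%N.
    by case/andP: sz => + _; apply: leq_trans; rewrite leq_pmull.
  have sz2 : (N.+1 * (r * r) <= size es - r * r < N.+2 * (r * r))%N.
    move: sz; rewrite (mulSn N.+1) (mulSn N.+2).
    by rewrite leq_subRL// ltn_subLR.
  set es1 := take (r * r) es; set es2 := drop (r * r) es.
  have ees : es = es1 ++ es2 by rewrite cat_take_drop.
  have sz1 : size es1 = (r * r)%N by rewrite size_takel.
  have me : means es = means es1 + means es2 by rewrite ees means_cat.
  set c' := c + means es1.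
  pose X := x%:~R - (c + means es).
  have XE : X = x%:~R - (c' + means es2) by rewrite /X me /c' addrA.
  pose p' := p + (X - p) / N.+2%:R.
  have NN : N.+2%:R = N.+1%:R + 1 :> R by rewrite natr1.
  have N0 : 0 < N.+1%:R :> R by rewrite ltr0n.
  have N0' : 0 < N.+2%:R :> R by rewrite ltr0n.
  have dp : `|p' - p| <= r%:R.
    rewrite /p' addrC addKr normrM [`|_^-1|]ger0_norm ?invr_ge0// ler_pdivrMr//.
    by rewrite mulrC.
  have hp' : `|p'| <= P.
    have -> : p' = (N.+1%:R * p + X) / N.+2%:R.
      by rewrite /p' NN; move: (N.+1%:R : R) N0 => u u0; field; rewrite gt_eqF//; lra.
    rewrite normrM [`|_^-1|]ger0_norm ?invr_ge0// ler_pdivrMr//.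
    rewrite (le_trans (ler_normD _ _))// normrM [`|_%:R|]ger0_norm// NN mulrDr mulr1.
    by rewrite lerD// mulrC ler_wpM2r.
  have hXp' : `|X - p'| <= N.+1%:R * r%:R.
    have -> : X - p' = (X - p) * (N.+1%:R / N.+2%:R).
      by rewrite /p' NN; move: (N.+1%:R : R) N0 => u u0; field; rewrite gt_eqF//; lra.
    rewrite normrM [`|_ / _|]ger0_norm ?divr_ge0// mulrA ler_pdivrMr//.
    by rewrite -mulrA [leRHS]mulrC ler_wpM2r// mulrC.
  pose g0 := Num.floor (c' + p').
  have g01 : g0%:~R <= c' + p' by exact: floor_le_tmp.
  have g02 : c' + p' < g0%:~R + 1 by rewrite -(intrD _ g0 1) floorD1_gt.
  pose s := [seq g0 + i%:Z | i <- iota 0 r].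
  have us : uniq s by rewrite map_inj_uniq ?iota_uniq// => i j /addrI[].
  have sr : size s = r by rewrite size_map size_iota.
  have hs g : g \in s -> `|g%:~R - c' - p'| <= 2 * r%:R.
    move=> /mapP[i]; rewrite mem_iota /= add0n => ir ->.
    have : i%:R <= r%:R :> R by rewrite ler_nat ltnW.
    have := ler0n R i.
    by rewrite intrD ler_norml => i0 ir'; apply/andP; split; rewrite -pmulrn; lra.
  set w := c2 ^+ N.+1 / r%:R.
  have w0 : 0 <= w by rewrite divr_ge0 ?exprn_ge0 ?(ltW c20).
  have hw g : g \in s -> w <= kill lam c' es2 (delta x) g.
    move=> gs; apply: IH => //.
    - by rewrite size_drop.
    - exact: hs.
    - exact: hp'.
    - by rewrite -XE.
    - by rewrite -XE.
  rewrite ees kill_cat -/c'.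
  apply: (@le_trans _ _ (kill lam c es1 (fun y => w * \sum_(g <- s) delta g y) z)).
    rewrite killZ; last exact: quad_sum.
    have -> : c2 ^+ N.+2 / r%:R = w * (r%:R * (c2 / r%:R)).
      by rewrite /w exprSr; field; rewrite gt_eqF.
    rewrite ler_wpM2l// -[X in X%:R * _]sr; apply: block => //.
      by rewrite sz1 leqnn mul2n -addnn -[ltnLHS]addn0 ltn_add2l muln_gt0 (leq_trans r00 rr).
    move=> g gs; have h := hs _ gs; rewrite -/c'; split.
      have := ler_normB (z%:~R - c - p) (g%:~R - c' - p').
      have := ler_normB (z%:~R - c - p - (g%:~R - c' - p')) (p' - p).
      rewrite (_ : _ - _ - _ = z%:~R + means es1 - g%:~R); last by rewrite /c'; ring.
      by lra.
    have := ler_normD (g%:~R - c' - p') p'; rewrite subrK; lra.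
  apply: kill_le.
  - by apply: quadZ; exact: quad_sum.
  - exact: quad_kill.
  - move=> y; rewrite mulr_sumr (@sum_deltaE R s (fun=> w))//.
    have [ys|_] := boolP (y \in s); first by rewrite mul1r hw.
    rewrite mul0r; apply: kill_ge0 => // u; by rewrite /delta ler0n.
(* r <= th lam leaves room for A r + 2 r between (1 - eps) lam and lam; since
   th <= 1/2, the target moves by at most r per block. *)
have [th [th0 th1 th2]] : exists th : R, [/\ 0 < th, th <= 1 / 2 & (A + 2) * th <= eps].
  have A2 : 0 < A + 2 by lra.
  exists (eps / (A + 2) / 2); split.
  - by rewrite !divr_gt0.
  - have : eps / (A + 2) <= 1 by rewrite ler_pdivrMr//; lra.
    by lra.
  - rewrite (_ : _ * _ = eps / 2); first by lra.
    by field; rewrite gt_eqF.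
exists 1, (4 / (c2 * th ^+ 2)), ((r0%:R + 2) / th); split=> //.
- by rewrite divr_gt0// mulr_gt0// exprn_gt0.
- by rewrite divr_gt0// ltr_wpDl.
move=> es x lam hlam sz hx.
have {}hlam : r0%:R + 2 <= th * lam by rewrite mulrC -ler_pdivrMr.
have lam0 : 0 < lam.
  by rewrite -(pmulr_rgt0 _ th0) (lt_le_trans _ hlam)// ltr_wpDl.
pose r := Num.truncn (th * lam).
have r1 : r%:R <= th * lam by rewrite truncn_le mulr_ge0 ?ltW.
have r2 : th * lam < r%:R + 1 by rewrite natr1 truncnS_gt.
have r0r : (r0 <= r)%N by rewrite -(ler_nat R); lra.
have rp : 0 < r%:R :> R by have := ler0n R r0; lra.
have rl : 2 * r%:R <= lam by nra.
pose N := (size es %/ (r * r))%N.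
have rr0 : (0 < r * r)%N by rewrite muln_gt0 -(ltr0n R) rp.
have rrn : (r * r <= size es)%N.
  by rewrite -(ler_nat R) (le_trans _ sz)// natrM expr2; nra.
have N0 : (0 < N)%N by rewrite divn_gt0.
have sN : (N * (r * r) <= size es < N.+1 * (r * r))%N.
  by rewrite leq_divM ltn_ceil.
have N0R : 1 <= N%:R :> R by rewrite ler1n.
have NR : (size es)%:R <= (N%:R + 1) * (r%:R * r%:R) :> R.
  by rewrite natr1 -!natrM ler_nat ltnW//; case/andP: sN.
have NR' : N%:R * (r%:R * r%:R) <= (size es)%:R :> R.
  by rewrite -!natrM ler_nat; case/andP: sN.
have key : c2 ^+ N / r%:R <= kill lam 0 es (delta x) 0.
  apply: (@chain r lam ((1 - eps) * lam) x r0r _ N es 0 0 0 N0 sN).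
  - by nra.
  - by rewrite !subr0 normr0 mulr_ge0.
  - by rewrite normr0 mulr_ge0 ?(ltW lam0)//; lra.
  - by rewrite add0r.
  - rewrite add0r subr0 (le_trans hx)//.
    apply: (@le_trans _ _ lam); first by nra.
    have : lam * lam <= N%:R * r%:R * lam.
      rewrite -expr2 (le_trans sz)// (le_trans NR)//.
      apply: (@le_trans _ _ (N%:R * r%:R * (2 * r%:R))).
        have := mulr_ge0 (mulr_ge0 (ltW rp) (ltW rp)) (_ : 0 <= N%:R - 1 :> R).
        by rewrite subr_ge0 => /(_ N0R); lra.
      by rewrite ler_wpM2l// mulr_ge0.
    by rewrite ler_pM2r.
apply: le_trans key; rewrite !mul1r.
(* exp (1/c2) >= 1/c2, so c2^N is at least exp (- N/c2). *)
have hc : expR (- c2^-1) <= c2.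
  rewrite expRN invf_ple ?posrE ?expR_gt0//.
  by apply: le_trans (expR_ge1Dx _); lra.
rewrite mulrC; apply: (@le_trans _ _ (c2 ^+ N / lam)); last first.
  rewrite ler_wpM2l ?exprn_ge0 ?(ltW c20)// lef_pV2 ?posrE//; lra.
rewrite ler_wpM2r ?invr_ge0 ?(ltW lam0)//.
apply: (@le_trans _ _ (expR (- c2^-1) ^+ N)); last first.
  by rewrite lerXn2r ?nnegrE ?expR_ge0 ?(ltW c20).
rewrite -expRM_natl ler_expR mulrN lerN2.
have -> : 4 / (c2 * th ^+ 2) * (size es)%:R / lam ^+ 2 =
    (4 * (size es)%:R / (th * lam) ^+ 2) / c2.
  by field; rewrite !gt_eqF.
rewrite ler_wpM2r ?invr_ge0 ?(ltW c20)// ler_pdivlMr ?exprn_gt0 ?mulr_gt0//.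
have ht : (th * lam) ^+ 2 <= 4 * (r%:R * r%:R).
  rewrite (_ : 4 * _ = (2 * r%:R) ^+ 2); last by ring.
  rewrite lerXn2r ?nnegrE ?mulr_ge0 ?(ltW th0) ?(ltW lam0)//.
  by have := ler0n R r0; lra.
apply: (@le_trans _ _ (N%:R * (4 * (r%:R * r%:R)))); last by lra.
by rewrite ler_wpM2l.
Qed.

End KillBounds.

(** * Irreducibility and aperiodicity *)

(** The least difference d of two elements divides every element: otherwise a
    remainder modulo d would be a smaller difference. Hence d = 1, and two
    consecutive elements generate all large integers. *)
Lemma numerical_semigroup (S : nat -> Prop) :
  S 0%N -> (forall m n, S m -> S n -> S (m + n)%N) ->
  (forall e, (forall n, (0 < n)%N -> S n -> (e %| n)%N) -> e = 1%N) ->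
  exists n0, forall n, (n0 <= n)%N -> S n.
Proof.
move=> S0 SD gcdS.
have SM k n : S n -> S (k * n)%N.
  by move=> Sn; elim: k => [|k IH]; rewrite ?mul0n// mulSn; exact: SD.
pose D d := (0 < d)%N && `[< exists2 u, S u & S (u + d)%N >].
have exD : exists d, D d.
  apply: contrapT => nD.
  have/gcdS // : forall n, (0 < n)%N -> S n -> (0 %| n)%N.
  move=> n n0 Sn; exfalso; apply: nD; exists n; rewrite /D n0; apply/asboolP.
  by exists 0%N; rewrite ?add0n.
case: (ex_minnP exD) => d /andP[d0 /asboolP[u Su Sud]] dmin.
have d1 : d = 1%N.
  apply: gcdS => n n0 Sn; rewrite /dvdn; apply: contraT; rewrite -lt0n => r0.
  have /dmin : D (n %% d)%N.
    rewrite /D r0; apply/asboolP; exists (n %/ d * (u + d))%N; first exact: SM.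
    rewrite mulnDr -addnA -divn_eq; apply: SD => //; exact: SM.
  by rewrite leqNgt ltn_mod d0.
subst d; exists (u * u)%N => n un.
have [u0|u0] := posnP u.
  by rewrite -[n]muln1; apply: SM; move: Sud; rewrite u0.
have qu : (n %% u <= n %/ u)%N.
  by rewrite (@leq_trans u)// ?leq_divRL// ltnW// ltn_mod.
rewrite (_ : n = (n %/ u - n %% u) * u + (n %% u) * (u + 1))%N.
  by apply: SD; apply: SM.
by rewrite mulnDr muln1 addnA -mulnDl subnK// -divn_eq.
Qed.

Section Paths.
Context {R : realType}.

(** Only the sign of the weights matters, so that positivity of the transition
    probabilities of the measure passes to the sequence that is proportional to
    it atom by atom. *)
Definition path_to (a : int -> R) (n : nat) (y : int) :=
  exists s : seq int, [/\ size s = n, forall i, i \in s -> 0 < a i &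
    \sum_(i <- s) i = y].

Lemma path_toD a m n x y :
  path_to a m x -> path_to a n y -> path_to a (m + n) (x + y).
Proof.
move=> [s [<- sa <-]] [t [<- ta <-]]; exists (s ++ t); split.
- by rewrite size_cat.
- by move=> i; rewrite mem_cat => /orP[/sa|/ta].
- by rewrite big_cat.
Qed.

Lemma nstep_ge0 (p : probability int R) n x y :
  (0 <= nstep (walk_transition p) n x y)%E.
Proof.
elim: n x y => [|n IH] x y /=; first by rewrite lee_fin ler0n.
by apply: esum_ge0 => z _; rewrite mule_ge0// /walk_transition measure_ge0.
Qed.

Lemma nstep_path_to (p : probability int R) (a : int -> R) n x y :
  (forall i, (0 < p [set i])%E -> 0 < a i) ->
  (0 < nstep (walk_transition p) n x y)%E -> path_to a n (y - x).
Proof.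
move=> pa; elim: n x => [|n IH] x /=.
  rewrite lte_fin ltr0n lt0b => /eqP ->; exists [::]; split=> //.
  by rewrite big_nil subrr.
move=> h.
have [z hz] : exists z, (0 < walk_transition p x z * nstep (walk_transition p) n z y)%E.
  apply: contrapT => nz; move: h; rewrite esum1 ?ltxx// => z _.
  apply/eqP; rewrite eq_le mule_ge0 ?nstep_ge0 ?measure_ge0// andbT leNgt.
  by apply/negP => hz; apply: nz; exists z.
have q0 : (0 < walk_transition p x z)%E.
  rewrite lt_neqAle measure_ge0 andbT eq_sym; apply/eqP => q0.
  by move: hz; rewrite q0 mul0e ltxx.
have n0 : (0 < nstep (walk_transition p) n z y)%E.
  rewrite lt_neqAle nstep_ge0 andbT eq_sym; apply/eqP => q1.
  by move: hz; rewrite q1 mule0 ltxx.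
rewrite (_ : y - x = (z - x) + (y - z)); last by ring.
rewrite -add1n; apply: path_toD; last exact: IH.
exists [:: z - x]; split=> //; last by rewrite big_seq1.
by move=> i; rewrite inE => /eqP ->; exact: pa.
Qed.

(** Return paths exist in all large lengths by aperiodicity; prefixing one fixed
    path from 0 to 1 gives paths to 1. *)
Lemma irreducible_aperiodic_path_to (a : int -> R) : irreducible_aperiodic_seq a ->
  exists L, forall n, (L <= n)%N -> path_to a n 0 /\ path_to a n 1.
Proof.
move=> [p [irr ap [b [b0 ab]]]].
have pa i : (0 < p [set i])%E -> 0 < a i.
  by move=> pi; rewrite -lte_fin ab mule_gt0// lte_fin.
have [n0 hn0] : exists n0, forall n, (n0 <= n)%N -> path_to a n 0.
  apply: numerical_semigroup.
  - by exists [::]; split=> //; rewrite big_nil.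
  - by move=> m n hm hn; rewrite -[0]addr0; exact: path_toD.
  - move=> e he; have [h _] := ap 0 e; apply/eqP; rewrite -dvdn1; apply: h => n n0 hn.
    by apply: he => //; have := nstep_path_to pa hn; rewrite subrr.
have [n1 /(nstep_path_to pa)] := irr 0 1; rewrite subr0 => hn1.
exists (n0 + n1)%N => n hn; split; first by apply: hn0; lia.
rewrite -[1]addr0 (_ : n = n1 + (n - n1))%N; last by lia.
by apply: path_toD => //; apply: hn0; lia.
Qed.

Lemma walk_path V (a : int -> R) (es : seq (law V a)) (s : seq int) z :
  size s = size es -> (forall i, i \in s -> 0 < a i) ->
  \prod_(i <- s) a i <= walk es (delta (z + \sum_(i <- s) i)) z.
Proof.
elim: es s z => [|E es IH] [|i s] z //= sz sa.
  by rewrite !big_nil addr0 /delta eqxx.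
rewrite !big_cons.
have qw : quad (fun y => walk es (delta (z + (i + \sum_(j <- s) j))) (z + y) : R).
  exact/quad_shift/quad_walk/quad_delta.
have := @ev_ge_atoms _ E [:: i] a _ isT qw.
rewrite big_seq1 => h; apply: le_trans (h _ _).
- rewrite ler_wpM2l ?(ltW (sa i (mem_head _ _)))// addrA; apply: IH; first by case: sz.
  by move=> j js; apply: sa; rewrite inE js orbT.
- by move=> y; apply: walk_ge0 => [|u]; [exact: quad_delta|rewrite /delta ler0n].
- by move=> j; rewrite inE => /eqP ->; exact: law_atom.
Qed.

Lemma irreducible_aperiodic_spreads V (a : int -> R) : 0 <= V ->
  irreducible_aperiodic_seq a -> exists L k, spreads V a L k.
Proof.
move=> V0 /irreducible_aperiodic_path_to[L0 hL].
pose Q l k := forall es : seq (law V a), size es = l ->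
  k <= walk es (delta 0) 0 /\ k <= walk es (delta 1) 0.
have exk l : (L0 < l)%N -> exists2 k, 0 < k & Q l k.
  move=> Ll; have [[s [ss sa s0]] [t [ts ta t1]]] := hL l (ltnW Ll).
  have prod0 (r : seq int) : (forall i, i \in r -> 0 < a i) -> 0 < \prod_(i <- r) a i.
    by move=> ra; rewrite big_seq; apply: prodr_gt0.
  exists (Num.min (\prod_(i <- s) a i) (\prod_(i <- t) a i)).
    by rewrite lt_min !prod0.
  move=> es esl; split; rewrite ge_min; apply/orP; [left|right].
  - by have := @walk_path V a es s 0; rewrite s0 addr0; apply; rewrite ?ss.
  - by have := @walk_path V a es t 0; rewrite t1 add0r; apply; rewrite ?ts.
have exk2 M : exists2 k, 0 < k & forall l, (L0 < l < M)%N -> Q l k.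
  elim: M => [|M [k k0 hk]]; first by exists 1 => // l; rewrite ltn0 andbF.
  have [LM|LM] := ltnP L0 M; last by exists 1 => // l ?; exfalso; lia.
  have [k' k'0 hk'] := exk _ LM; exists (Num.min k k'); first by rewrite lt_min k0.
  move=> l /andP[Ll]; rewrite ltnS leq_eqVlt => /orP[/eqP ->|lM] es esl.
    by have [h1 h2] := hk' _ esl; split; rewrite ge_min ?h1 ?h2 orbT.
  have [|h1 h2] := hk l _ _ esl; first by rewrite Ll.
  by split; rewrite ge_min ?h1 ?h2.
have [k k0 hk] := exk2 (L0.+1.*2); exists L0.+1, (Num.min k (1 / 2)); split=> //.
  by rewrite lt_min k0 ge_min lexx orbT !andbT; lra.
by move=> es sz; have [h1 h2] := hk _ sz _ erefl; split; rewrite ge_min ?h1 ?h2.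
Qed.

End Paths.

(** * From random variables to functionals *)

Lemma measurable_set_int (A : set int) : measurable A.
Proof. by []. Qed.

Section OneVariable.
Context {R : realType} {d : measure_display} {T : measurableType d}.
Context {P : probability T R}.
Implicit Types (X : {RV P >-> int}) (h : int -> R).

Lemma measurable_int_comp X (h : int -> \bar R) :
  measurable_fun setT (fun w => h (X w)).
Proof. by apply: (@measurableT_comp _ _ _ _ _ _ h). Qed.

Lemma measurable_RV_preimage X (A : set int) : measurable (X @^-1` A).
Proof. by rewrite -[X @^-1` A]setTI; exact: measurable_funP. Qed.

Lemma integral_discrete X (g : int -> R) : (forall k, 0 <= g k) ->
  (\int[P]_w (g (X w))%:E =
   \esum_(k in [set: int]) (distribution P X [set k] * (g k)%:E))%E.
Proof.
move=> g0; pose F n := X @^-1` [set k | pickle k = n].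
have FT : \bigcup_n F n = setT.
  by rewrite -subTset => w _; exists (pickle (X w)).
have mg : measurable_fun setT (fun w => (g (X w))%:E).
  exact: (measurable_int_comp X (fun k => (g k)%:E)).
rewrite -[X in integral _ X _]FT ge0_integral_bigcup//; last first.
- apply/trivIsetP => i j _ _ /eqP ij; rewrite -subset0 => w [wi wj].
  by apply: ij; exact: etrans (esym wi) wj.
- by move=> w _; rewrite lee_fin.
- by rewrite FT.
- by move=> n; exact: measurable_RV_preimage.
rewrite nneseries_esumT; last by move=> n; apply: integral_ge0 => w _; rewrite lee_fin.
have injp : set_bij [set: int] (range (@pickle int)) pickle.
  split; [by move=> k _; exists k| |by move=> n [k _ <-]; exists k].
  by move=> i j _ _; exact: (pcan_inj pickleK).
transitivity (\esum_(n in range (@pickle int)) \int[P]_(w in F n) (g (X w))%:E)%E.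
  rewrite [RHS]esum_mkcond; apply: eq_esum => n _; case: ifPn => // /negP nr.
  rewrite (_ : F n = set0) ?integral_set0// -subset0 => w /= wn.
  by apply: nr; rewrite inE; exists (X w).
rewrite (@reindex_esum _ _ _ _ _ _ _ injp); apply: eq_esum => k _.
rewrite (_ : F (pickle k) = X @^-1` [set k]); last first.
  apply/seteqP; split => w /=; first exact: (pcan_inj pickleK).
  by move=> wk; rewrite /F /= wk.
transitivity (\int[P]_(w in X @^-1` [set k]) (g k)%:E)%E.
  by apply: eq_integral => w; rewrite inE /= => ->.
rewrite integral_cst; last exact: measurable_RV_preimage.
by rewrite muleC.
Qed.

(** The exponential moments at both ends of the interval control the square,
    since u^2 <= 4 (exp u + exp (-u)). *)
Lemma second_moment_le X (del c : R) (a : int -> R) : 0 < del ->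
  Mclass del c a (distribution P X) ->
  (\int[P]_w (((X w)%:~R) ^+ 2)%:E <= (8 * c / del ^+ 2)%:E)%E.
Proof.
move=> del0 [hsup _].
have expm t : `|t| <= del -> (\int[P]_w (expR (t * (X w)%:~R))%:E <= c%:E)%E.
  move=> ht; rewrite (integral_discrete X (fun k => expR_ge0 (t * k%:~R))).
  by apply: le_trans hsup; apply: ereal_sup_ubound; exists t.
have hp := expm del _; have hm := expm (- del) _.
rewrite normrN gtr0_norm// lexx in hp hm; move: (hp isT) (hm isT) => {}hp {}hm.
have sq (u : R) : u ^+ 2 <= 4 * (expR u + expR (- u)).
  wlog u0 : u / 0 <= u => [hw|].
    have [/hw//|/ltW u0] := leP 0 u.
    by have := hw (- u); rewrite sqrrN opprK oppr_ge0 addrC => ->.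
  apply: (@le_trans _ _ (4 * expR u)); last by rewrite ler_pM2l// lerDl expR_ge0.
  have h : u / 2 <= expR (u / 2).
    by apply: le_trans (expR_ge1Dx _); rewrite lerDr.
  have -> : expR u = expR (u / 2) ^+ 2 by rewrite -expRM_natl; congr expR; field.
  have : (u / 2) ^+ 2 <= expR (u / 2) ^+ 2 by rewrite lerXn2r// nnegrE ?expR_ge0 ?divr_ge0.
  by rewrite expr_div_n ler_pdivrMr// (_ : 2 ^+ 2 = 4) 1?mulrC//; ring.
have me (t : R) : measurable_fun setT (fun w => (expR (t * (X w)%:~R))%:E).
  exact: (measurable_int_comp X (fun k => (expR (t * k%:~R))%:E)).
apply: (@le_trans _ _ (\int[P]_w ((4 / del ^+ 2)%:E *
    ((expR (del * (X w)%:~R))%:E + (expR (- del * (X w)%:~R))%:E)))%E).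
  apply: ge0_le_integral => //.
  - by move=> w _; rewrite lee_fin sqr_ge0.
  - exact: (measurable_int_comp X (fun k => (k%:~R ^+ 2)%:E)).
  - exact: (measurable_int_comp X (fun k => (4 / del ^+ 2)%:E *
      ((expR (del * k%:~R))%:E + (expR (- del * k%:~R))%:E))%E).
  - move=> w _; rewrite -EFinD -EFinM lee_fin mulrAC ler_pdivlMr ?exprn_gt0//.
    by have := sq (del * (X w)%:~R); rewrite exprMn mulrC mulNr.
rewrite ge0_integralZl//; last 3 first.
- by apply: emeasurable_funD; exact: me.
- by move=> w _; rewrite adde_ge0// lee_fin expR_ge0.
- by rewrite lee_fin divr_ge0 ?exprn_ge0 ?ltW.
rewrite ge0_integralD//; try by move=> w _; rewrite lee_fin expR_ge0.
apply: (@le_trans _ _ ((4 / del ^+ 2)%:E * (c%:E + c%:E))%E).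
  apply: lee_wpmul2l; last exact: (leeD hp hm).
  by rewrite lee_fin divr_ge0// exprn_ge0// ltW.
by rewrite -EFinD -EFinM lee_fin le_eqVlt; apply/orP; left; apply/eqP; ring.
Qed.

Lemma integrable_quad X h (V : R) :
  (\int[P]_w (((X w)%:~R) ^+ 2)%:E <= V%:E)%E -> quad h ->
  P.-integrable setT (EFin \o (h \o X)).
Proof.
move=> hV [C hC].
have i2 : P.-integrable setT (EFin \o (fun w => (X w)%:~R ^+ 2)).
  apply/integrableP; split; first exact: (measurable_int_comp X (fun k => (k%:~R ^+ 2)%:E)).
  under eq_integral => w _ do rewrite /= ger0_norm ?sqr_ge0//.
  by apply: le_lt_trans hV _; rewrite ltry.
have i1 : P.-integrable setT (EFin \o (cst (1 : R))).
  by apply: finite_measure_integrable_cst.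
have ig : P.-integrable setT (EFin \o (fun w => C * (1 + (X w)%:~R ^+ 2))).
  have := integrableZl measurableT C (integrableD measurableT i1 i2).
  by apply: eq_integrable.
apply: le_integrable ig => //; first exact: (measurable_int_comp X (EFin \o h)).
move=> w _ /=; rewrite lee_fin (le_trans (hC _))//; exact: ler_norm.
Qed.

Section LawOf.
Variables (X : {RV P >-> int}) (V : R).
Hypothesis hV : (\int[P]_w (((X w)%:~R) ^+ 2)%:E <= V%:E)%E.

Definition mean_op_of : mean_op (R := R).
Proof.
apply: (@MeanOp R (fun h => Rintegral P setT (h \o X))).
- rewrite /comp Rintegral_cst//.
  have e : fine (P setT) = 1 :> R by rewrite probability_setT.
  by rewrite mul1r; exact: e.
- move=> r h g qh qg.
  have ih := integrable_quad hV qh; have ig := integrable_quad hV qg.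
  rewrite -RintegralZl// -RintegralD//.
  exact: (integrable_quad hV (quadZ r qh)).
- by move=> h _ hge; apply: Rintegral_ge0 => w _; exact: hge.
Defined.

Lemma mean_op_of_delta y :
  (mean_op_of (delta y))%:E = P (X @^-1` [set y]).
Proof.
rewrite /= /Rintegral fineK; last first.
  apply: integrable_fin_num => //; exact: (integrable_quad hV (quad_delta y)).
transitivity (\int[P]_w (\1_(X @^-1` [set y]) w)%:E)%E; last first.
  by rewrite integral_indic ?setIT//; exact: measurable_RV_preimage.
apply: eq_integral => w _; rewrite /= /delta indicE; congr ((nat_of_bool _)%:R%:E).
by apply/idP/idP => [/eqP e|/set_mem /= ->//]; exact: mem_set.
Qed.

Lemma exists_law (a : int -> R) : (forall i, ((a i)%:E <= distribution P X [set i])%E) ->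
  exists E : law V a, [/\ ev_mean E = fine 'E_P[fun w => (X w)%:~R] &
    forall y, (E (delta y))%:E = P (X @^-1` [set y])].
Proof.
move=> ha.
have v : ev_variance mean_op_of <= V.
  rewrite /ev_variance; apply: (@le_trans _ _ (mean_op_of (fun y => y%:~R ^+ 2))).
    by rewrite lerBlDr lerDl sqr_ge0.
  rewrite -lee_fin /= /Rintegral fineK//.
  by apply: integrable_fin_num => //; exact: (integrable_quad hV (quad_id2)).
have at_ i : a i <= mean_op_of (delta i).
  by rewrite -lee_fin mean_op_of_delta; exact: ha.
exists (Law v at_); split.
- by rewrite /ev_mean /= unlock.
- exact: mean_op_of_delta.
Qed.

End LawOf.
End OneVariable.

(** * The event as a killed walk *)

Section Event.
Context {R : realType} {d : measure_display} {T : measurableType d}.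
Context {P : probability T R} {n : nat}.
Variables (X : 'I_n -> {RV P >-> int}) (V : R) (a : int -> R).
Variable E : 'I_n -> law V a.
Hypothesis Emean : forall i, ev_mean (E i) = mean X i.
Hypothesis Eatom : forall i y, ((E i) (delta y))%:E = P (X i @^-1` [set y]).
Hypothesis indep : independent_RVs X.

(** The event of the theorem, restarted from the position [z] when only the steps
    of the list [s] remain; [c] is the mean already accumulated. *)
Fixpoint stays (lam : R) (x : int) (s : seq 'I_n) (c : R) (z : int) (w : T) : Prop :=
  `|z%:~R - c| <= lam /\
  if s is i :: s' then stays lam x s' (c + mean X i) (z + X i w) w else z = x.

Lemma measurable_stays lam x s c z : measurable [set w | stays lam x s c z w].
Proof.
elim: s c z => [|i s IH] c z /=.
  by have [e|ne] := pselect (`|z%:~R - c| <= lam /\ z = x);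
    [rewrite (_ : [set _ | _] = setT)|rewrite (_ : [set _ | _] = set0)] => //;
    apply/seteqP; split.
have [zc|zc] := pselect (`|z%:~R - c| <= lam); last first.
  rewrite (_ : [set _ | _] = set0)//; apply/seteqP; split => // w [] //.
rewrite (_ : [set _ | _] = \bigcup_(u in [set: int]) (X i @^-1` [set u] `&`
    [set w | stays lam x s (c + mean X i) (z + u) w])).
  apply: countable_bigcupT_measurable => // u.
  by apply: measurableI => //; exact: measurable_RV_preimage.
apply/seteqP; split => w /=; first by move=> [_ h]; exists (X i w).
by move=> [u _ [/= <- ]].
Qed.

Lemma measure_split (Y : {RV P >-> int}) (s : seq int) (A : set T) :
  uniq s -> measurable A ->
  (P (A `&` [set w | Y w \in s]) = \sum_(u <- s) P (A `&` Y @^-1` [set u]))%E.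
Proof.
move=> us mA; elim: s us => [_|u s IH /= /andP[us' us]].
  rewrite big_nil (_ : _ `&` _ = set0) ?measure0//.
  by apply/seteqP; split => // w [].
have mY (B : set int) : measurable (Y @^-1` B) by exact: measurable_RV_preimage.
rewrite big_cons -IH// -measureU.
- congr (P _); apply/seteqP; split => w /=.
    by move=> [Aw]; rewrite inE => /orP[/eqP ->|ys]; [left|right].
  by move=> [[Aw /= ->]|[Aw ys]]; split => //; rewrite inE ?eqxx// ys orbT.
- exact: measurableI.
- by apply: measurableI => //; exact: (mY [set u | u \in s]).
- apply/seteqP; split => // w [[_ /= e] [_]] /=.
  by rewrite e (negbTE us').
Qed.

Definition prefix_event (J : {set 'I_n}) (y : 'I_n -> int) : set T :=
  [set w | forall i, i \in J -> [set y i] (X i w)].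

Lemma measurable_prefix_event J y : measurable (prefix_event J y).
Proof.
rewrite (_ : prefix_event J y = \bigcap_(i in [set` J]) (X i @^-1` [set y i])).
  by apply: fin_bigcap_measurable => // i _; exact: measurable_RV_preimage.
by apply/seteqP; split => w h i /h.
Qed.

Lemma prefix_eventU1 (J : {set 'I_n}) y i u : i \notin J ->
  prefix_event J y `&` X i @^-1` [set u] =
  prefix_event (i |: J) (fun j => if j == i then u else y j).
Proof.
move=> iJ; apply/seteqP; split => w /=.
  move=> [h e] j; rewrite !inE; case: eqP => [->//|_] /= /h //.
move=> h; split.
  move=> j jJ; have := h j; rewrite !inE jJ orbT => /(_ isT).
  by case: eqP => // ji; move: iJ; rewrite -ji jJ.
by have := h i; rewrite !inE eqxx => /(_ isT).
Qed.

Lemma measure_prefix_eventU1 (J : {set 'I_n}) y i u : i \notin J ->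
  P (prefix_event J y `&` X i @^-1` [set u]) =
  (P (prefix_event J y) * P (X i @^-1` [set u]))%E.
Proof.
move=> iJ; rewrite prefix_eventU1// /prefix_event.
have h (K : {set 'I_n}) (y' : 'I_n -> int) :
    P [set w | forall i, i \in K -> [set y' i] (X i w)] =
    (\prod_(i in K) P (X i @^-1` [set y' i]))%E.
  exact: (@indep K (fun i => [set y' i]) (fun i _ => measurable_set_int _)).
rewrite !h big_setU1//= eqxx muleC; congr (_ * _)%E.
apply: eq_bigr => j jJ; case: eqP => // ji.
by move: iJ; rewrite -ji jJ.
Qed.

(** Conditioning on the values of finitely many other steps makes the statement
    inductive, as revealing the next step only enlarges this set. The strip
    leaves finitely many values for the next step, so a finite sum is enough. *)
Lemma measure_stays lam x s c z (J : {set 'I_n}) y : 0 <= lam -> uniq s ->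
  (forall i, i \in s -> i \notin J) ->
  (P (prefix_event J y `&` [set w | stays lam x s c z w]) =
   P (prefix_event J y) * (kill lam c (map E s) (delta x) z)%:E)%E.
Proof.
move=> lam0; elim: s c z J y => [|i s IH] c z J y us sJ.
  rewrite /=; case: ifP => zc; last first.
    rewrite mule0 (_ : _ `&` _ = set0) ?measure0//.
    by apply/seteqP; split => // w [_ /= [zc' _]]; rewrite zc' in zc.
  rewrite /delta; case: eqP => [zx|zx].
    by rewrite mule1; congr (P _); apply/seteqP; split => // w [].
  rewrite mule0 (_ : _ `&` _ = set0) ?measure0//.
  by apply/seteqP; split => // w [_ []].
case/andP: us => si us.
rewrite [map _ _]/= [kill _ _ _ _ _]/=; case: ifP => zc; last first.
  rewrite mule0 (_ : _ `&` _ = set0) ?measure0//.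
  by apply/seteqP; split => // w [_ /= [zc' _]]; rewrite zc' in zc.
rewrite Emean; set c' := c + mean X i.
set K := kill lam c' (map E s) (delta x).
have qK : quad K by exact/quad_kill/quad_delta.
have K0 y' : ~~ (`|y'%:~R - c'| <= lam) -> K y' = 0.
  by rewrite /K; case: (s) => [|j s'] /= /negbTE ->.
have [|W [uW WE _]] := @int_window R (fun u => `|(z + u)%:~R - c'| <= lam) (c' - z%:~R) lam lam0.
  by move=> u; rewrite intrD opprB addrA (addrC _ z%:~R).
have inW u : (u \in W) = (`|(z + u)%:~R - c'| <= lam) by exact: WE.
set B := prefix_event J y.
have mB : measurable B by exact: measurable_prefix_event.
set A := B `&` [set w | stays lam x s c' (z + X i w) w].
have sub w : stays lam x s c' (z + X i w) w -> X i w \in W.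
  by rewrite inW; case: (s) => [|j s'] /= [].
have cut u : A `&` X i @^-1` [set u] =
    (B `&` X i @^-1` [set u]) `&` [set w | stays lam x s c' (z + u) w].
  apply/seteqP; split => w [[Bw h] h'].
    by split; [split|move: h h' => /= h <-].
  by split=> //; split=> //; move: h h' => /= ->.
have -> : B `&` [set w | stays lam x (i :: s) c z w] = A `&` [set w | X i w \in W].
  apply/seteqP; split => w [Bw].
    by move=> [_ h]; split; [|exact: sub].
  by case: Bw => Bw h _; split.
have mA : measurable A.
  rewrite (_ : A = B `&` [set w | stays lam (x : int) (i :: s) c z w]).
    by apply: measurableI => //; exact: measurable_stays.
  apply/seteqP; split => w [Bw h]; split=> //.
  exact: (proj2 h).
rewrite measure_split//.
have EK : E i (fun u => K (z + u)) = \sum_(u <- W) K (z + u) * E i (delta u).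
  transitivity (E i (fun u => \sum_(v <- W) K (z + v) * delta v u)).
    congr (ev (E i) _); apply/funext => u.
    rewrite (@sum_deltaE R W (fun v => K (z + v)))// inW.
    have [h|h] := boolP (`|(z + u)%:~R - c'| <= lam); first by rewrite mul1r.
    by rewrite mul0r K0.
  rewrite ev_sum; last by move=> v; exact/quadZ/quad_delta.
  by apply: eq_bigr => v _; rewrite evZ//; exact: quad_delta.
rewrite EK; have iJ : i \notin J by apply: sJ; rewrite mem_head.
have PB : P B = (fine (P B))%:E by rewrite fineK// fin_num_measure.
transitivity (\sum_(u <- W) (fine (P B) * (K (z + u) * E i (delta u)))%:E)%E.
  apply: eq_bigr => u _; rewrite cut prefix_eventU1// IH//; last first.
    move=> j js; rewrite !inE negb_or sJ ?inE ?js ?orbT// andbT.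
    by apply: contraNneq si => <-.
  rewrite -prefix_eventU1// measure_prefix_eventU1// -Eatom -/B PB -/K.
  by rewrite -!EFinM; congr (_%:E); ring.
by rewrite sumEFin -mulr_sumr EFinM -PB.
Qed.

Lemma staysP lam x s c z w : stays lam x s c z w <->
  (forall k, (k <= size s)%N ->
    `|z%:~R - c + \sum_(i <- take k s) ((X i w)%:~R - mean X i)| <= lam) /\
  z + \sum_(i <- s) X i w = x.
Proof.
elim: s c z => [|i s IH] c z /=.
  have -> : z + \sum_(i <- [::]) X i w = z by rewrite big_nil addr0.
  split=> [[h e]|[h e]]; split=> //.
    by move=> k _; rewrite big_nil addr0.
  by have := h 0%N isT; rewrite big_nil addr0.
rewrite IH big_cons addrA; split=> [[h0 [h e]]|[h e]]; split=> //.
- move=> [|k] ks; first by rewrite /= big_nil addr0.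
  have := h k ks; rewrite /= big_cons intrD; congr (`|_| <= _).
  by ring.
- by have := h 0%N isT; rewrite /= big_nil addr0.
split=> // k ks; have := h k.+1 ks; rewrite /= big_cons intrD; congr (`|_| <= _).
by ring.
Qed.

Lemma sum_take_enum k (F : 'I_n -> R) :
  \sum_(i <- take k (enum 'I_n)) F i = \sum_(i < n | (i < k)%N) F i.
Proof.
transitivity (\sum_(i <- enum 'I_n | (i < k)%N) F i); last by rewrite big_enum_cond.
rewrite -[RHS]big_filter; congr (\sum_(i <- _) F i).
apply: (inj_map val_inj); rewrite map_take.
transitivity [seq j <- iota 0 n | (j < k)%N]; last by rewrite -val_enum_ord filter_map.
rewrite val_enum_ord.
have [kn|nk] := leqP k n.
  by rewrite take_iota (minn_idPl kn); exact: esym (filter_iota_ltn 0 kn).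
rewrite take_oversize ?size_iota ?(ltnW nk)//; apply/esym/all_filterP/allP => j.
by rewrite mem_iota /= add0n => /ltn_trans; apply.
Qed.

Lemma measure_stay_and_hit (lam x : R) (x' : int) : 0 <= lam ->
  x'%:~R - total_mean X = x ->
  P (stay_and_hit X lam x) =
  (kill lam 0 (map E (enum 'I_n)) (delta x') 0)%:E.
Proof.
move=> lam0 xx'.
have csn w : centered_sum X n w = \sum_(i < n) (X i w)%:~R - total_mean X.
  by rewrite /total_mean -sumrB; apply: eq_bigl => i; rewrite ltn_ord.
have -> : stay_and_hit X lam x =
    prefix_event finset.set0 (fun=> 0) `&` [set w | stays lam x' (enum 'I_n) 0 0 w].
  apply/seteqP; split => w.
    move=> [hmax hx]; split; first by move=> i; rewrite inE.
    apply/staysP; split.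
      move=> [|k] kn; first by rewrite take0 big_nil subr0 addr0 normr0.
      rewrite subr0 add0r sum_take_enum; apply: le_trans hmax.
      rewrite size_enum_ord in kn.
      rewrite (@le_bigmax_seq _ _ _ _ _ k.+1 predT (fun k => `|centered_sum X k w|))//.
      by rewrite mem_index_iota ltnS.
    rewrite add0r; apply/eqP; rewrite -(eqr_int R) rmorph_sum/=.
    by rewrite big_enum/= -[X in _ == X](subrK (total_mean X)) xx' -hx csn subrK.
  move=> [_ /staysP[h e]]; split.
    rewrite big_seq; apply: bigmax_le => // k; rewrite mem_index_iota => /andP[_ kn].
    have := h k; rewrite size_enum_ord subr0 add0r sum_take_enum; exact.
  by rewrite -xx' -e add0r rmorph_sum/= big_enum/= csn.
rewrite measure_stays ?enum_uniq//; last by move=> i; rewrite inE.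
rewrite (_ : prefix_event _ _ = setT) ?probability_setT ?mul1e//.
by apply/seteqP; split => // w _ i; rewrite inE.
Qed.

End Event.

(** * The theorem *)

Theorem theorem5p5 (R : realType) (c0 delta0 : R) (a : int -> R) (eps : R) :
  0 < c0 -> 0 < delta0 ->
  (forall i, 0 <= a i <= 1) -> irreducible_aperiodic_seq a ->
  0 < eps ->
  exists (cminus cplus C lambda0 : R) (n0 : nat),
    [/\ 0 < cminus, 0 < cplus, 0 < C, 0 <= lambda0 & (1 <= n0)%N] /\
    forall (n : nat), (n0 <= n)%N ->
    forall (d : measure_display) (T : measurableType d) (P : probability T R)
      (X : 'I_n -> {RV P >-> int}),
      independent_RVs X ->
      (forall i, Mclass delta0 c0 a (distribution P (X i))) ->
      (forall lambda x : R,
         lambda0 <= lambda <= Num.sqrt n%:R ->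
         shifted_Z (total_mean X) x ->
         `|x| <= (1 - eps) * lambda ->
         ((1 / (C * lambda) * expR (- (cminus * n%:R / lambda ^+ 2)))%:E
           <= P (stay_and_hit X lambda x))%E)
      /\
      (forall lambda x : R,
         lambda0 <= lambda <= Num.sqrt n%:R ->
         shifted_Z (total_mean X) x ->
         `|x| <= lambda ->
         (P (stay_and_hit X lambda x)
           <= (C / lambda * expR (- (cplus * n%:R / lambda ^+ 2)))%:E)%E).
Proof.
move=> c00 del0 _ airr eps0.
pose V := 8 * c0 / delta0 ^+ 2.
have V0 : 0 <= V by rewrite divr_ge0 ?exprn_ge0 ?mulr_ge0 ?ltW.
have [L [k Lk]] := irreducible_aperiodic_spreads V0 airr.
have [C1 [c1 [C10 c10 upper]]] := kill_delta_upper Lk.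
(* A smaller eps only strengthens the lower bound. *)
pose eps' := Num.min eps 1.
have eps'01 : 0 < eps' <= 1 by rewrite lt_min eps0 ltr01 ge_min lexx orbT.
have [C2 [c2 [lam0 [C20 c20 lam00 lower]]]] := kill_delta_lower Lk eps'01.
exists c2, c1, (Num.max C1 C2), (Num.max lam0 1), 1%N; split.
  by split=> //; rewrite ?lt_max ?C10// le_max ler01 orbT.
move=> n n0 d T P X indep hM.
have hE i : exists E : law V a, ev_mean E = mean X i /\
    forall y, (E (delta y))%:E = P (X i @^-1` [set y]).
  have [E [h1 h2]] := exists_law (second_moment_le del0 (hM i)) (hM i).2.
  by exists E.
have [E hE'] := choice hE.
have Emean i := (hE' i).1; have Eatom i := (hE' i).2.
pose es := map E (enum 'I_n).
have ses : size es = n by rewrite size_map size_enum_ord.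
have mes : means es = total_mean X.
  rewrite /means big_map big_enum /=; apply: eq_bigr => i _; exact: Emean.
have prep lambda : Num.max lam0 1 <= lambda <= Num.sqrt n%:R ->
    [/\ lam0 <= lambda, 1 <= lambda & lambda ^+ 2 <= (size es)%:R].
  rewrite ge_max => /andP[/andP[h1 h2] h3]; split=> //.
  rewrite ses -[leRHS]sqr_sqrtr// lerXn2r ?nnegrE ?sqrtr_ge0//.
  by apply: le_trans h2.
split=> lambda x /prep[l0 l1 l2] [x' _ xx'] hx; have lp : 0 < lambda by lra.
- rewrite (measure_stay_and_hit Emean Eatom indep (ltW lp) xx') lee_fin.
  have hx' : `|x'%:~R - means es| <= (1 - eps') * lambda.
    rewrite mes xx' (le_trans hx)// ler_wpM2r ?(ltW lp)// lerD2l lerN2.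
    by rewrite ge_min lexx.
  apply: le_trans (lower es x' lambda l0 l2 hx').
  rewrite ses ler_wpM2r ?expR_ge0// ler_pM2l// lef_pV2 ?posrE ?mulr_gt0//.
    by rewrite ler_pM2r// le_max lexx orbT.
  by rewrite lt_max C10.
- rewrite (measure_stay_and_hit Emean Eatom indep (ltW lp) xx') lee_fin.
  apply: (le_trans (upper es x' 0 lambda l1 l2)).
  rewrite ses ler_wpM2r ?expR_ge0// ler_wpM2r ?invr_ge0 ?(ltW lp)//.
  by rewrite le_max lexx.
Qed.
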